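(* Let $s,d$ be positive integers, let $\widetilde K_{d,s}(x,t)=\prod_{j=1}^dK_{1,s}(x_j,t_j)$ for $x,t\in\mathbb{R}^d$, where $K_{1,s}$ is the reproducing kernel of $W^s_2(\mathbb{R})$, and let $H(\widetilde K_{d,s})$ be the reproducing kernel Hilbert space on $\mathbb{R}^d$ with kernel $\widetilde K_{d,s}$. Let $\widetilde I_{d,s}$ be the embedding from $H(\widetilde K_{d,s})$ to $L_\infty(\mathbb{R}^d)$. Then for every probability density $\rho_d:\mathbb{R}^d\to[0,\infty)$ and every positive integer $n$ there exist points $x_1^*,x_2^*,\dots,x_n^*\in\mathbb{R}^d$ such that $$ e(x_1^*,x_2^*,\dots,x_n^* )\le\frac{\|\widetilde I_{d,s}\|}{\sqrt n}=\frac{\widetilde K_{d,s}(0,0)^{1/2}}{\sqrt n}=\frac{K_{1,s}(0,0)^{d/2}}{\sqrt n}\le\frac{K_{1,1}(0,0)^{d/2}}{\sqrt n}\le\frac{2^{-d/2}}{\sqrt n}. $$ Consequently, for any choice of positive integers $s=s(d)$ and of probability densities $\rho_d$, $d=1,2,\dots$, the integration problem over the spaces $H(\widetilde K_{d,s})$ is strongly polynomially tractable for the absolute error criterion.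
   Context: $W^s_2(\mathbb{R})$ is the Sobolev space of functions $f\in L_2(\mathbb{R})$ whose weak derivatives $f^{(k)}$, $k=1,\dots,s$, belong to $L_2(\mathbb{R})$, with inner product $\sum_{k=0}^s\int_{\mathbb{R}}f^{(k)}(x)\overline{g^{(k)}(x)}\,\mathrm{d}x$; elements are identified with their continuous representatives, so it is a reproducing kernel Hilbert space. The space $H(\widetilde K_{d,s})$ is the $d$-fold (Hilbert) tensor product of $W^s_2(\mathbb{R})$; it consists of bounded continuous functions. The norm of the embedding is $\|\widetilde I_{d,s}\|=\sup_{f\ne0}\|f\|_{L_\infty(\mathbb{R}^d)}/\|f\|_{H(\widetilde K_{d,s})}$. A probability density is a measurable function $\rho_d\ge0$ with $\int_{\mathbb{R}^d}\rho_d(x)\,\mathrm{d}x=1$, and the integration problem is $S_{\rho_d}(f)=\int_{\mathbb{R}^d}f(x)\rho_d(x)\,\mathrm{d}x$ for $f\in H(\widetilde K_{d,s})$. For points $x_1,\dots,x_n\in\mathbb{R}^d$, $$e(x_1,\dots,x_n)=\sup_{\|f\|_{H(\widetilde K_{d,s})}\le1}\left|S_{\rho_d}(f)-\frac1n\sum_{j=1}^nf(x_j)\right|.$$ The information complexity $n(\varepsilon,d)$ is the minimal $n$ for which there is an algorithm $A(f)=\varphi(f(x_1),\dots,f(x_n))$ (with points $x_j\in\mathbb{R}^d$ and a mapping $\varphi$) satisfying $\sup_{\|f\|_{H(\widetilde K_{d,s})}\le1}|S_{\rho_d}(f)-A(f)|\le\varepsilon$. Strong polynomial tractability for the absolute error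 criterion means that there are constants $C,p\ge0$ such that $n(\varepsilon,d)\le C\varepsilon^{-p}$ for all $\varepsilon\in(0,1]$ and all $d\in\mathbb{N}$. *)

(* Defs.v *)
From HB Require Import structures.
From mathcomp Require Import all_boot all_order all_algebra.
From mathcomp Require Import all_classical all_reals all_analysis.
From mathcomp Require Import complex.

Set Implicit Arguments.
Unset Strict Implicit.
Unset Printing Implicit Defensive.

Import Order.TTheory GRing.Theory Num.Theory.
Import numFieldNormedType.Exports.

Local Open Scope classical_set_scope.
Local Open Scope ring_scope.

(* Points of R^d are d-tuples; the sigma-algebra generated by the coordinate
   projections is the Borel sigma-algebra. *)
Notation Rpow R d := (d.-tuple (measurableTypeR R)).

Section TupleMeasure.
Context (R : realType) (d : nat).

Definition cons_pair (p : measurableTypeR R * Rpow R d) : Rpow R d.+1 :=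
  [the Rpow R d.+1 of p.1 :: p.2].

Lemma measurable_cons_pair : measurable_fun setT cons_pair.
Proof. exact: measurable_cons. Qed.

Definition uncons_pair (x : Rpow R d.+1) : measurableTypeR R * Rpow R d :=
  (thead x, [tuple of behead x]).

Lemma measurable_uncons_pair : measurable_fun setT uncons_pair.
Proof.
apply/measurable_fun_pair; last exact: measurable_behead.
exact: measurable_tnth.
Qed.

Lemma cons_pairK : cancel cons_pair uncons_pair.
Proof. by case=> a t; congr pair; apply: val_inj. Qed.

Lemma uncons_pairK : cancel uncons_pair cons_pair.
Proof. by move=> x; rewrite [RHS]tuple_eta; apply: val_inj. Qed.

Variable m : {sigma_finite_measure set (Rpow R d) -> \bar R}.

Definition tuple_step : set (Rpow R d.+1) -> \bar R :=
  pushforward (@lebesgue_measure R \x m)%E cons_pair.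

Let tuple_step0 : tuple_step set0 = 0%E.
Proof. by rewrite /tuple_step /pushforward preimage_set0 measure0. Qed.

Let tuple_step_ge0 A : (0 <= tuple_step A)%E.
Proof. exact: (measure_ge0 (@lebesgue_measure R \x m)%E). Qed.

Let tuple_step_sigma_additive : semi_sigma_additive tuple_step.
Proof.
move=> F mF tF mUF; rewrite /tuple_step /pushforward preimage_bigcup.
apply: (@measure_semi_sigma_additive _ _ _ (@lebesgue_measure R \x m)%E).
- by move=> n; rewrite -[X in measurable X]setTI; exact: measurable_cons_pair.
- apply/trivIsetP => /= i j _ _ ij; rewrite -preimage_setI.
  by move/trivIsetP : tF => /(_ _ _ _ _ ij) ->//; rewrite preimage_set0.
- by rewrite -preimage_bigcup -[X in measurable X]setTI;
    exact: measurable_cons_pair.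
Qed.

HB.instance Definition _ := isMeasure.Build _ _ _
  tuple_step tuple_step0 tuple_step_ge0 tuple_step_sigma_additive.

Let tuple_step_sigma_finite : sigma_finite setT tuple_step.
Proof.
have /sigma_finiteP[F [TF ndF Foo]] := sigma_finiteT (@lebesgue_measure R).
have /sigma_finiteP[G [TG ndG Goo]] := sigma_finiteT m.
exists (fun n => uncons_pair @^-1` (F n `*` G n)).
  apply/seteqP; split => // x _.
  have [i _ Fi] : (\bigcup_i F i) (uncons_pair x).1 by rewrite -TF.
  have [j _ Gj] : (\bigcup_i G i) (uncons_pair x).2 by rewrite -TG.
  exists (maxn i j) => //; split.
  - by move: Fi; exact/subsetPset/ndF/leq_maxl.
  - by move: Gj; exact/subsetPset/ndG/leq_maxr.
move=> n; have [mF Fn] := Foo n; have [mG Gn] := Goo n.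
have mFG : measurable (F n `*` G n) by exact: measurableX.
split.
  by rewrite -[X in measurable X]setTI; exact: measurable_uncons_pair.
rewrite /tuple_step /pushforward (_ : _ @^-1` _ = F n `*` G n); last first.
  by rewrite -[RHS]preimage_id -(funext cons_pairK : uncons_pair \o cons_pair = id).
by rewrite product_measure1E// lte_mul_pinfty// ge0_fin_numE.
Qed.

HB.instance Definition _ := Measure_isSigmaFinite.Build _ _ _
  tuple_step tuple_step_sigma_finite.

End TupleMeasure.

Fixpoint lebesgue_pow (R : realType) (d : nat) :
    {sigma_finite_measure set (Rpow R d) -> \bar R} :=
  match d with
  | 0 => [the {sigma_finite_measure set (Rpow R 0) -> \bar R}
            of dirac ([tuple] : Rpow R 0)]
  | d'.+1 => [the {sigma_finite_measure set (Rpow R d'.+1) -> \bar R}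
            of tuple_step (lebesgue_pow R d')]
  end.

(* The integral is taken componentwise; it has its usual meaning only for
   integrable f. *)
Definition cintegral (R : realType) d (T : measurableType d)
    (mu : {measure set T -> \bar R}) (f : T -> R[i]) : R[i] :=
  Complex (\int[mu]_x complex.Re (f x)) (\int[mu]_x complex.Im (f x)).

Section ComplexFunctions.
Context (R : realType).
Local Notation leb := (@lebesgue_measure R).
Local Notation cnorm := (@Normc.normc R).

(* These are functions, not classes modulo a.e. equality. *)
Definition square_integrable (f : measurableTypeR R -> R[i]) : Prop :=
  [/\ measurable_fun setT (fun x => complex.Re (f x) : measurableTypeR R),
      measurable_fun setT (fun x => complex.Im (f x) : measurableTypeR R) &
      (\int[leb]_x (cnorm (f x) ^+ 2)%:E < +oo)%E].

Definition ccontinuous (f : R -> R[i]) : Prop :=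
  continuous (fun x => complex.Re (f x)) /\
  continuous (fun x => complex.Im (f x)).

(* Real test functions suffice: both sides of the identity defining a weak
   derivative are linear in the test function. *)
Definition test_function (phi : R -> R) : Prop :=
  (forall n x, derivable (derive1n n phi) x 1) /\
  (exists M : R, forall x, M < `|x| -> phi x = 0).

Definition weak_derivative (k : nat) (f g : R -> R[i]) : Prop :=
  forall phi, test_function phi ->
    cintegral leb (fun x => f x * (derive1n k phi x)%:C%C) =
    (-1) ^+ k * cintegral leb (fun x => g x * (phi x)%:C%C).

(* A chosen square-integrable representative of the k-th weak derivative, which
   is unique up to a.e. equality; the default value 0 is used only when there
   is none. *)
Definition wderiv (k : nat) (f : R -> R[i]) : R -> R[i] :=
  if k is 0 then f
  else xget (fun=> 0)
         [set g | square_integrable g /\ weak_derivative k f g].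

End ComplexFunctions.

(* A set of complex-valued functions with a form on it; the values of [fs_ip]
   outside [fs_mem] are irrelevant. *)
Record funspace (R : realType) (X : Type) := FunSpace {
  fs_mem : set (X -> R[i]) ;
  fs_ip : (X -> R[i]) -> (X -> R[i]) -> R[i] }.

Section FunSpaces.
Context (R : realType) (X : Type).
Implicit Types (V : funspace R X) (f g h : X -> R[i]).

Definition fs_norm V f : R := Num.sqrt (complex.Re (fs_ip V f f)).

Definition hilbert_funspace V : Prop :=
  [/\ fs_mem V (fun=> 0) /\
      (forall (a : R[i]) f g, fs_mem V f -> fs_mem V g ->
         fs_mem V (fun x => a * f x + g x)),
      forall (a : R[i]) f g h, fs_mem V f -> fs_mem V g -> fs_mem V h ->
        fs_ip V (fun x => a * f x + g x) h = a * fs_ip V f h + fs_ip V g h,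
      forall f g, fs_mem V f -> fs_mem V g ->
        fs_ip V g f = conjc (fs_ip V f g),
      forall f, fs_mem V f -> f <> (fun=> 0) -> 0 < fs_ip V f f &
      forall u : nat -> X -> R[i], (forall n, fs_mem V (u n)) ->
        (forall e : R, 0 < e -> exists N, forall m n, (N <= m)%N -> (N <= n)%N ->
           fs_norm V (fun x => u m x - u n x) < e) ->
        exists2 f, fs_mem V f &
          fs_norm V (fun x => u n x - f x) @[n --> \oo] --> (0 : R)].

Definition reproducing_kernel V (K : X -> X -> R[i]) : Prop :=
  (forall t, fs_mem V (K ^~ t)) /\
  (forall f t, fs_mem V f -> f t = fs_ip V f (K ^~ t)).

(* By the Moore-Aronszajn theorem at most one set of functions with at most one
   inner product satisfies this for a given K. *)
Definition rkhs V (K : X -> X -> R[i]) : Prop :=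
  hilbert_funspace V /\ reproducing_kernel V K.

End FunSpaces.

Definition sobolev (R : realType) (s : nat) : funspace R R :=
  FunSpace
    [set f | [/\ ccontinuous f, square_integrable f &
       forall k, (1 <= k <= s)%N ->
         exists g, square_integrable g /\ weak_derivative k f g]]
    (fun f g => \sum_(0 <= k < s.+1)
       cintegral (@lebesgue_measure R)
         (fun x => wderiv k f x * conjc (wderiv k g x))).

Definition tensor_kernel (R : realType) (d : nat) (K : R -> R -> R[i])
    (x t : Rpow R d) : R[i] :=
  \prod_(j < d) K (tnth x j) (tnth t j).

Definition origin (R : realType) (d : nat) : Rpow R d :=
  [tuple (0 : measurableTypeR R) | j < d].

Section Integration.
Context (R : realType) (d : nat).
Local Notation mu := (lebesgue_pow R d).
Local Notation cnorm := (@Normc.normc R).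
Implicit Types (V : funspace R (Rpow R d)) (rho : Rpow R d -> R).

Definition embedding_norm V : \bar R :=
  ereal_sup
    [set (Lnorm mu +oo (fun x => (cnorm (f x))%:E) * ((fs_norm V f)^-1)%:E)%E
    | f in [set f | fs_mem V f /\ f <> (fun=> 0)]].

Definition probability_density rho : Prop :=
  [/\ measurable_fun setT (rho : Rpow R d -> measurableTypeR R),
      forall x, 0 <= rho x &
      (\int[mu]_x (rho x)%:E = 1)%E].

Definition integration_problem rho (f : Rpow R d -> R[i]) : R[i] :=
  cintegral mu (fun x => f x * (rho x)%:C%C).

Definition worst_case_error V rho (A : (Rpow R d -> R[i]) -> R[i]) : \bar R :=
  ereal_sup [set (cnorm (integration_problem rho f - A f))%:E
            | f in [set f | fs_mem V f /\ fs_norm V f <= 1]].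

Definition qmc_error V rho (n : nat) (x : 'I_n -> Rpow R d) : \bar R :=
  worst_case_error V rho (fun f => n%:R^-1 * \sum_(j < n) f (x j)).

(* An infimum of natural numbers, hence a minimum, unless no number of points
   suffices, when it is +oo; n = 0 stands for constant algorithms. *)
Definition information_complexity V rho (eps : R) : \bar R :=
  ereal_inf [set (n%:R)%:E | n in [set n : nat |
    exists (x : 'I_n -> Rpow R d) (phi : ('I_n -> R[i]) -> R[i]),
      (worst_case_error V rho (fun f => phi (fun j => f (x j))) <= eps%:E)%E]].

End Integration.

Definition strongly_polynomially_tractable (R : realType)
    (V : forall d, funspace R (Rpow R d)) (rho : forall d, Rpow R d -> R) : Prop :=
  exists C p : R, [/\ 0 <= C, 0 <= p &
    forall (eps : R) (d : nat), 0 < eps <= 1 -> (0 < d)%N ->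
      (information_complexity (V d) (@rho d) eps <= (C * eps `^ (- p))%:E)%E].

(* Main.v *)
Require Import Defs.
From mathcomp Require Import all_boot all_order all_algebra.
From mathcomp Require Import all_classical all_reals all_analysis.
From mathcomp Require Import complex.
From mathcomp Require Import measurable_realfun ess_sup_inf ring lra.

Set Implicit Arguments.
Unset Strict Implicit.
Unset Printing Implicit Defensive.

Import Order.TTheory GRing.Theory Num.Theory.
Import numFieldNormedType.Exports.

Local Open Scope classical_set_scope.
Local Open Scope ring_scope.

(** The argument has an analytic half, about [K1 s], and a Hilbert space half,
    about any reproducing kernel with constant diagonal.

    On the line, translating a function preserves its Sobolev norm.  The inner
    product is computed from chosen weak derivatives, so this rests on the
    uniqueness of weak derivatives ([weak_derivative_unique]); together with
    the additive form of the Cauchy-Schwarz inequality ([young_form]) it makes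
    [K1 s t t] independent of [t] ([kernel_diag]).  The same inequality shows
    that [K1 s 0 0] decreases with [s], because the norm grows with [s]
    ([kernel_diag_antitone]), and that it is positive, because test functions
    belong to the space ([sobolev_kernel_diag_gt0]).  For [s = 1] the bound 1/2
    is the inequality [2 u(0)^2 <= int (u^2 + u'^2)], obtained by integrating
    the derivatives of [exp(-x) u] on the right of the origin and of
    [exp(x) u] on the left ([weak_pair_bound]).  Both the uniqueness of weak
    derivatives and this integration come from one statement, the fundamental
    theorem of calculus for weak derivatives ([weak_FTC]): a weak derivative is
    tested against the difference of two ever steeper smooth steps.

    In a Hilbert space of functions with [K(x,x) <= k0] everywhere, integration
    against a probability density is a bounded functional, hence represented by
    some [h] ([riesz_representation]).  Good points are found one at a time:
    with [r] the residual [sum_j (K(.,x_j) - h)], the average over [x] of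
    [|r + K(.,x) - h|^2] with respect to the density is at most
    [|r|^2 + k0 - |h|^2], since [<r, K(.,x)>] averages to [<r, h>] and
    [<h, K(.,x)>] to [|h|^2]; so some [x] does at least as well
    ([greedy_residual]).  After [n] steps the residual has squared norm at most
    [n k0], and the worst-case error is its norm divided by [n].

    The embedding constant is [sqrt k0] by the Cauchy-Schwarz inequality, the
    kernel at the origin being extremal: it is continuous there, and every cube
    has positive measure, so that the essential supremum sees its value
    ([embedding_normE]).  Tractability holds with exponent 2 because the bound
    on the error is at most [1 / sqrt n] in every dimension. *)

(** * Smooth functions and a smooth step *)
Section Smooth.
Context {R : realType}.
Implicit Types (f g : R -> R) (n k : nat) (x : R).

(** The recursion goes through the derivative, and not through iterated
    derivatives, so that product, quotient and composition rules follow by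
    induction on [n] for all functions at once; [smoothP] is the bridge to
    iterated derivatives. *)
Fixpoint Cdiff n f : Prop :=
  (forall x, derivable f x 1) /\ (if n is m.+1 then Cdiff m (derive1 f) else True).

Definition smooth f := forall n, Cdiff n f.

Lemma derive1_is f df : (forall x, is_derive x 1 f (df x)) -> derive1 f = df.
Proof. by move=> h; apply/funext => x; rewrite derive1E; exact: derive_val. Qed.

Lemma CdiffSI n f df :
  (forall x, is_derive x 1 f (df x)) -> Cdiff n df -> Cdiff n.+1 f.
Proof.
move=> h hn /=; split; last by rewrite (derive1_is h).
by move=> x; have [] := h x.
Qed.

Lemma Cdiff_derivable n f : Cdiff n f -> forall x, derivable f x 1.
Proof. by case: n => [|n] []. Qed.
Arguments Cdiff_derivable {n f} _ x.

Lemma Cdiff_derive n f : Cdiff n.+1 f -> Cdiff n (derive1 f).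
Proof. by case. Qed.

Lemma CdiffW n f : Cdiff n.+1 f -> Cdiff n f.
Proof.
elim: n f => [|n IH] f [df h]; first by split.
by split=> //; apply: IH.
Qed.

Lemma CdiffD n f g : Cdiff n f -> Cdiff n g -> Cdiff n (fun x => f x + g x).
Proof.
elim: n f g => [|n IH] f g hf hg.
  by split=> // x; apply: derivableD; [case: hf|case: hg].
apply: (@CdiffSI _ _ (fun x => derive1 f x + derive1 g x)); last first.
  by apply: IH; exact: Cdiff_derive.
move=> x; have := Cdiff_derivable hf x; have := Cdiff_derivable hg x.
by move=> /derivableP ? /derivableP ?; rewrite !derive1E; exact: is_deriveD.
Qed.

Lemma CdiffM n f g : Cdiff n f -> Cdiff n g -> Cdiff n (fun x => f x * g x).
Proof.
elim: n f g => [|n IH] f g hf hg.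
  by split=> // x; apply: derivableM; [case: hf|case: hg].
apply: (@CdiffSI _ _ (fun x => f x * derive1 g x + g x * derive1 f x)); last first.
  by apply: CdiffD; apply: IH; (exact: CdiffW || exact: Cdiff_derive).
move=> x; have := Cdiff_derivable hf x; have := Cdiff_derivable hg x.
by move=> /derivableP ? /derivableP ?; rewrite !derive1E; exact: is_deriveM.
Qed.

Lemma Cdiff_cst n (c : R) : Cdiff n (fun=> c).
Proof.
elim: n c => [|n IH] c; first by split=> // x; exact: derivable_cst.
by apply: (@CdiffSI _ _ (fun=> 0)) => // x; exact: is_derive_cst.
Qed.

Lemma CdiffV n f : (forall x, f x != 0) -> Cdiff n f ->
  Cdiff n (fun x => (f x)^-1).
Proof.
move=> f0; elim: n => [|n IH] hf.
  by split=> // x; apply: derivableV => //; case: hf.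
apply: (@CdiffSI _ _ (fun x => (-1) * ((f x)^-1 * (f x)^-1) * derive1 f x)).
  move=> x; have /derivableP h := Cdiff_derivable hf x.
  have := is_deriveV (f0 x) h; rewrite -derive1E => h'.
  by apply: is_derive_eq; rewrite /GRing.scale /= mulN1r -invfM -expr2.
have hV := IH (CdiffW hf).
apply: CdiffM; last exact: Cdiff_derive.
by apply: CdiffM; [exact: Cdiff_cst|exact: CdiffM].
Qed.

Lemma Cdiff_affine n f (a b : R) : Cdiff n f -> Cdiff n (fun x => f (a * x + b)).
Proof.
elim: n f => [|n IH] f hf.
  split=> // x; case: hf => hf _; have /derivableP h := hf (a * x + b).
  have ha : is_derive x 1 (fun x : R => a * x + b) a.
    by apply: is_derive_eq; rewrite /GRing.scale /=; ring.
  by have [] := @is_derive1_comp _ f (fun y : R => a * y + b) x _ _ h ha.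
apply: (@CdiffSI _ _ (fun x => a * derive1 f (a * x + b))); last first.
  by apply: CdiffM; [exact: Cdiff_cst|apply/IH/Cdiff_derive].
move=> x; have /derivableP h := Cdiff_derivable hf (a * x + b).
have ha : is_derive x 1 (fun x : R => a * x + b) a.
  by apply: is_derive_eq; rewrite /GRing.scale /=; ring.
by have := @is_derive1_comp _ f (fun y : R => a * y + b) x _ _ h ha; rewrite -derive1E mulrC.
Qed.

Lemma Cdiff_expR n : Cdiff n (@expR R).
Proof. by elim: n => [|n IH]; [split=> // x|apply: (CdiffSI (df := expR))]. Qed.

Lemma smoothP f : smooth f <-> forall n x, derivable (derive1n n f) x 1.
Proof.
split=> [h n x|h n].
  suff : smooth (derive1n n f) by move=> /(_ 0%N)[].
  by elim: n => // n IH m; rewrite derive1nS; exact/Cdiff_derive/IH.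
elim: n f h => [|n IH] f h; first by split=> // x; exact: (h 0%N).
split=> [x|]; first exact: (h 0%N).
by apply: IH => m x; rewrite /derive1n -iterSr; exact: (h m.+1).
Qed.

Lemma smooth_derive f : smooth f -> smooth (derive1 f).
Proof. by move=> h n; exact/Cdiff_derive/(h n.+1). Qed.

Lemma smooth_derivable f : smooth f -> forall x, derivable f x 1.
Proof. by move=> /(_ 0%N)[]. Qed.
Arguments smooth_derivable {f} _ x.

Lemma smooth_is_derive f : smooth f -> forall x, is_derive x 1 f ((derive1 f) x).
Proof.
by move=> hf x; have /derivableP := smooth_derivable hf x; rewrite derive1E.
Qed.

Lemma smooth_continuous f : smooth f -> continuous f.
Proof.
by move=> h x; apply/differentiable_continuous/derivable1_diffP/smooth_derivable.
Qed.

(** The functions [x^-k exp(-1/x)], extended by 0 to [x <= 0].  Unlike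
    [exp(-1/x)] alone, the family is stable under differentiation up to linear
    combinations, which gives smoothness by induction. *)
Definition flat k x : R := if 0 < x then x^-1 ^+ k * expR (- x^-1) else 0.

Lemma flat_le0 k x : x <= 0 -> flat k x = 0.
Proof. by rewrite /flat leNgt => /negbTE ->. Qed.

Lemma flat_gt0 x : 0 < x -> 0 < flat 0 x.
Proof. by move=> x0; rewrite /flat x0 expr0 mul1r expR_gt0. Qed.

Lemma flat_ge0 k x : 0 <= flat k x.
Proof.
rewrite /flat; case: ifPn => // x0.
by rewrite mulr_ge0 ?expR_ge0// exprn_ge0// invr_ge0 ltW.
Qed.

Lemma flatS k x : flat k.+1 x * x = flat k x.
Proof.
rewrite /flat; case: ifPn => x0; last by rewrite mul0r.
rewrite exprS (mulrC x^-1) -!mulrA; congr (_ * _).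
by rewrite mulrCA mulVf ?mulr1// gt_eqF.
Qed.

(** The exponential dominates the term of degree [k + 1] of its series at [1/x]. *)
Lemma flat_bound k x : `|flat k x| <= k.+1`!%:R * `|x|.
Proof.
rewrite /flat; case: ifPn => x0; last by rewrite normr0 mulr_ge0.
have y0 : 0 <= x^-1 by rewrite invr_ge0 ltW.
rewrite (ger0_norm (mulr_ge0 (exprn_ge0 _ y0) (expR_ge0 _))) (gtr0_norm x0).
rewrite expRN ler_pdivrMr ?expR_gt0// mulrAC -ler_pdivrMr//.
rewrite -exprSr mulrC -ler_pdivrMr ?ltr0n ?fact_gt0//.
by apply: le_trans (@expR_ge1Dxn R x^-1 k y0); rewrite lerDr.
Qed.

(** At the origin the slope of [flat k] is [flat k.+1] by [flatS], and it is
    continuous there by [flat_bound]. *)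
Lemma is_derive_flat k x :
  is_derive x 1 (flat k) (flat k.+2 x - k%:R * flat k.+1 x).
Proof.
have [x0|x0|->] := ltgtP x 0.
- rewrite !(flat_le0 _ (ltW x0)) mulr0 subr0.
  apply: (@near_eq_is_derive R R R (cst 0)).
  by near=> y; rewrite flat_le0// ltW//; near: y; exact: lt_nbhsl.
- apply: (@near_eq_is_derive R R R (fun y => y^-1 ^+ k * expR (- y^-1))).
    by near=> y; rewrite /flat ifT//; near: y; exact: lt_nbhsr.
  rewrite /flat x0.
  have xn0 : x != 0 by rewrite gt_eqF.
  have hV := @is_deriveV R id x 1 1 xn0 (is_derive_id _ _).
  have hE : is_derive x 1 (fun y : R => expR (- y^-1)) (expR (- x^-1) * x ^- 2).
    have hN := @is_deriveN _ _ _ _ _ _ _ hV.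
    apply: (@is_derive_eq _ _ _ _ _ _ _ _
      (@is_derive1_comp _ expR (fun y => - y^-1) x _ _ (is_derive_expR _) hN)).
    by rewrite /GRing.scale /= mulr1 opprK.
  have hX := @is_deriveX _ _ _ k _ _ _ hV.
  rewrite exprfctE in hX.
  have hM := is_deriveM hX hE.
  apply: (is_derive_eq hM).
  rewrite /GRing.scale /= mulr1.
  case: k {hX hM} => [|k]; first by field.
  by rewrite /= !exprS; field.
rewrite !flat_le0// mulr0 subr0; apply/is_derive1_caratheodory.
exists (flat k.+1); split; last by rewrite flat_le0.
  by move=> z; rewrite subr0 flatS (flat_le0 k (lexx 0)) subr0.
rewrite /prop_for /continuous_at flat_le0//.
apply/cvgr0Pnorm_le => e e0; near=> y.
apply: le_trans (flat_bound _ _) _; rewrite mulrC -ler_pdivlMr ?ltr0n ?fact_gt0//.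
near: y; have := @cvgr0_norm_le R R R (nbhs (0:R)) _ id (@cvg_id _ _); apply.
by rewrite divr_gt0// ltr0n fact_gt0.
Unshelve. all: by end_near. Qed.

Lemma Cdiff_flat n k : Cdiff n (flat k).
Proof.
elim: n k => [|n IH] k.
  by split=> // x; have [] := is_derive_flat k x.
apply: (CdiffSI (is_derive_flat k)); apply: CdiffD => //.
rewrite (_ : (fun x => _) = (fun x => (- k%:R) * flat k.+1 x)); last first.
  by apply/funext => x; rewrite mulNr.
by apply: CdiffM => //; exact: Cdiff_cst.
Qed.

Definition step x : R := flat 0 x * (flat 0 x + flat 0 (-1 * x + 1))^-1.

Let step_den x : 0 < flat 0 x + flat 0 (-1 * x + 1).
Proof.
have [x0|x0] := ltP 0 x; first by rewrite ltr_pwDl ?flat_gt0 ?flat_ge0.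
rewrite ltr_wpDl ?flat_ge0// flat_gt0//; lra.
Qed.

Lemma smooth_step : smooth step.
Proof.
move=> n; apply: CdiffM; first exact: Cdiff_flat.
apply: CdiffV; first by move=> x; rewrite gt_eqF// step_den.
apply: CdiffD; first exact: Cdiff_flat.
by apply: (@Cdiff_affine _ (flat 0)); exact: Cdiff_flat.
Qed.

Lemma step_le0 x : x <= 0 -> step x = 0.
Proof. by move=> x0; rewrite /step flat_le0// mul0r. Qed.

Lemma step_ge1 x : 1 <= x -> step x = 1.
Proof.
move=> x1; rewrite /step (@flat_le0 _ (-1 * x + 1)) ?addr0; last by lra.
by rewrite divff// gt_eqF// flat_gt0// (lt_le_trans _ x1).
Qed.

Lemma step_ge0 x : 0 <= step x.
Proof. by rewrite /step mulr_ge0 ?flat_ge0// invr_ge0 ltW// step_den. Qed.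

Lemma step_le1 x : step x <= 1.
Proof. by rewrite /step ler_pdivrMr ?step_den// mul1r lerDl flat_ge0. Qed.

End Smooth.

(** * The fundamental theorem of calculus for weak derivatives *)
Section WeakFTC.
Context {R : realType}.
Local Notation mu := (@lebesgue_measure R).
Implicit Types (f g u v w phi : R -> R) (a b x : R) (n : nat).

Lemma derive1_cst_near f x (c : R) : (\forall y \near x, f y = c) -> derive1 f x = 0.
Proof.
move=> h; rewrite derive1E (@near_eq_derive R R R f (cst c)) ?derive_cst//.
Qed.

Lemma derive_step0 x : x < 0 \/ 1 < x -> derive1 step x = 0.
Proof.
case=> hx.
- apply: (@derive1_cst_near _ _ 0); near=> y; rewrite step_le0// ltW//.
  by near: y; exact: lt_nbhsl.
- apply: (@derive1_cst_near _ _ 1); near=> y; rewrite step_ge1// ltW//.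
  by near: y; exact: lt_nbhsr.
Unshelve. all: by end_near. Qed.

(** The derivative vanishes outside the compact interval from 0 to 1. *)
Lemma derive_step_bounded : exists2 C : R, 0 < C & forall x, `|derive1 step x| <= C.
Proof.
have cs : {within `[0, 1], continuous (derive1 (@step R))}.
  by apply: continuous_subspaceT; exact/smooth_continuous/smooth_derive/smooth_step.
have [C [_ hC]] := compact_bounded (continuous_compact cs (@segment_compact R 0 1)).
exists (Num.max 1 (C + 1)); first by rewrite lt_max ltr01.
move=> x; rewrite le_max; apply/orP.
have [x0|x0] := ltP x 0; first by rewrite derive_step0; [left; rewrite normr0|left].
have [x1|x1] := ltP 1 x; first by rewrite derive_step0; [left; rewrite normr0|right].
right; apply: (hC (C + 1)); first by rewrite ltrDl.
by exists x => //=; rewrite in_itv /= x0.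
Qed.

(** A smooth step that rises from 0 to 1 between [a] and [a + 1/(n + 1)]. *)
Definition ramp n a x := step (n.+1%:R * x + - (n.+1%:R * a)).

Lemma smooth_ramp n a : smooth (ramp n a).
Proof. by move=> m; apply: (@Cdiff_affine _ _ step); exact: smooth_step. Qed.

Lemma derive_ramp n a x :
  derive1 (ramp n a) x = n.+1%:R * derive1 step (n.+1%:R * x + - (n.+1%:R * a)).
Proof.
have h := smooth_is_derive (@smooth_step R) (n.+1%:R * x + - (n.+1%:R * a)).
have ha : is_derive x 1 (fun x : R => n.+1%:R * x + - (n.+1%:R * a)) n.+1%:R.
  by apply: is_derive_eq; rewrite /GRing.scale /=; ring.
have := @is_derive1_comp _ step (fun y : R => n.+1%:R * y + - (n.+1%:R * a)) x _ _ h ha.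
by move=> [_ hd]; rewrite mulrC -hd derive1E.
Qed.

Lemma ramp_le n a x : x <= a -> ramp n a x = 0.
Proof.
by move=> xa; rewrite /ramp step_le0// -mulrBr pmulr_rle0// subr_le0.
Qed.

Lemma ramp_ge n a x : a + n.+1%:R^-1 <= x -> ramp n a x = 1.
Proof.
move=> xa; rewrite /ramp step_ge1// -mulrBr mulrC -ler_pdivrMr// mul1r.
by rewrite lerBrDr addrC.
Qed.

Lemma ramp01 n a x : 0 <= ramp n a x <= 1.
Proof. by rewrite step_ge0 step_le1. Qed.

Lemma derive_ramp0 n a x : ~ (a <= x <= a + n.+1%:R^-1) ->
  derive1 (ramp n a) x = 0.
Proof.
move=> h; rewrite derive_ramp derive_step0 ?mulr0//.
have [xa|ax] := ltP x a.
  by left; rewrite -mulrBr pmulr_rlt0// subr_lt0.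
right; rewrite -mulrBr mulrC -ltr_pdivrMr// mul1r ltrBrDr addrC ltNge.
by apply/negP => h'; apply: h; rewrite ax.
Qed.

Lemma continuous_integrable_itv f a b : continuous f ->
  mu.-integrable `[a, b] (EFin \o f).
Proof.
move=> cf; apply: continuous_compact_integrable; first exact: segment_compact.
exact: continuous_subspaceT.
Qed.

Lemma Rintegral_support f (A : set R) : (forall x, ~ A x -> f x = 0) ->
  \int[mu]_x f x = \int[mu]_(x in A) f x.
Proof.
move=> h; rewrite [RHS]Rintegral_mkcond; congr Rintegral; apply/funext => x.
rewrite patchE; case: ifPn => // /negP; rewrite inE => /h //.
Qed.

Lemma integrable_support f (A : set R) : measurable A ->
  (forall x, ~ A x -> f x = 0) ->
  mu.-integrable A (EFin \o f) -> mu.-integrable setT (EFin \o f).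
Proof.
move=> mA h; rewrite [X in X -> _]integrable_mkcond//.
congr (_.-integrable _ _); apply/funext => x.
by rewrite patchE; case: ifPn => // /negP; rewrite inE /= => /h ->.
Qed.

Lemma integral_derive_ramp n a :
  \int[mu]_(x in `[a, a + n.+1%:R^-1]) derive1 (ramp n a) x = 1.
Proof.
rewrite /Rintegral (@continuous_FTC2 _ _ (ramp n a)).
- by rewrite ramp_ge// ramp_le//= subr0.
- by rewrite ltrDl invr_gt0.
- by apply: continuous_subspaceT; exact/smooth_continuous/smooth_derive/smooth_ramp.
- split; first by move=> x _; exact/smooth_derivable/smooth_ramp.
  + by apply: cvg_at_right_filter; exact/smooth_continuous/smooth_ramp.
  + by apply: cvg_at_left_filter; exact/smooth_continuous/smooth_ramp.
- by [].
Qed.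

(** The derivative of a ramp has integral 1, lives on an interval of length
    [1/(n + 1)] and is at most [C (n + 1)], so it is an approximate identity
    at [a] even where it changes sign. *)
Lemma ramp_approx_identity w a : continuous w ->
  \int[mu]_x (w x * derive1 (ramp n a) x) @[n --> \oo] --> w a.
Proof.
move=> cw; have [C C0 hC] := derive_step_bounded.
apply/cvgrPdist_le => e e0.
have /cvgrPdist_le /(_ _ (divr_gt0 e0 C0)) := cw a.
move=> [d /= d0 hd].
near=> n.
have nd : n.+1%:R^-1 < d.
  by near: n; exact: near_infty_natSinv_lt (PosNum d0).
have n0 : 0 < n.+1%:R^-1 :> R by rewrite invr_gt0.
set A := `[a, a + n.+1%:R^-1]%classic.
have mA : measurable (A : set (measurableTypeR R)) by exact: measurable_itv.
have cr : continuous (derive1 (ramp n a)).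
  exact/smooth_continuous/smooth_derive/smooth_ramp.
have cwr : continuous (fun x => w x * derive1 (ramp n a) x).
  by move=> x; apply: cvgM; [exact: cw|exact: cr].
rewrite (@Rintegral_support _ A); last first.
  by move=> x nA; rewrite derive_ramp0 ?mulr0// => h; apply: nA; rewrite /A /= in_itv.
have iwr : mu.-integrable A (EFin \o (fun x => w x * derive1 (ramp n a) x)).
  exact: continuous_integrable_itv.
have icr : mu.-integrable A (EFin \o (fun x => w a * derive1 (ramp n a) x)).
  by apply: continuous_integrable_itv => x; apply: cvgM; [exact: cvg_cst|exact: cr].
rewrite -[X in `|X - _|]mulr1 -(integral_derive_ramp n a) -RintegralZl//; last first.
  exact: continuous_integrable_itv.
rewrite -RintegralB//.
have id : mu.-integrable A (EFin \o
    (fun x => w a * derive1 (ramp n a) x - w x * derive1 (ramp n a) x)).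
  by apply: continuous_integrable_itv => x; apply: cvgB;
    [apply: cvgM; [exact: cvg_cst|exact: cr]|exact: cwr].
apply: le_trans (le_normr_Rintegral mA id) _.
apply: (@le_trans _ _ (\int[mu]_(x in A) (e * n.+1%:R))).
  apply: le_Rintegral => //.
  - apply: continuous_integrable_itv => x.
    apply: (@cvg_norm _ R^o); apply: cvgB;
    [apply: cvgM; [exact: cvg_cst|exact: cr]|exact: cwr].
  - by apply: continuous_integrable_itv => x; exact: cvg_cst.
  - move=> x; rewrite /A /= in_itv /= => /andP[ax xa].
    rewrite -mulrBl normrM derive_ramp normrM (ger0_norm (ler0n _ _)).
    rewrite (mulrC n.+1%:R) mulrA ler_pM2r//.
    apply: (@le_trans _ _ (e / C * C)); last by rewrite divfK// gt_eqF.
    apply: ler_pM => //; apply: hd => /=.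
    by rewrite distrC ger0_norm ?subr_ge0//; apply: le_lt_trans nd; rewrite lerBlDl.
have muA : mu A = (n.+1%:R^-1)%:E.
  rewrite /A; have := @lebesgue_measure_itv R `[a, a + n.+1%:R^-1].
  by rewrite /= lte_fin ltrDl n0 -EFinB addrAC subrr add0r.
rewrite (Rintegral_cst _ mA) (_ : fine _ = n.+1%:R^-1); last exact: congr1 muA.
by rewrite -mulrA divff ?mulr1.
Unshelve. all: by end_near. Qed.

Lemma test_function_ramps n a b : test_function (fun x => ramp n a x - ramp n b x).
Proof.
split.
  apply/smoothP => m; have -> : (fun x => ramp n a x - ramp n b x) =
      (fun x => ramp n a x + (-1) * ramp n b x).
    by apply/funext => x; rewrite mulN1r.
  by apply: CdiffD; [|apply: CdiffM; [exact: Cdiff_cst|]]; exact: smooth_ramp.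
exists (`|a| + `|b| + 1) => x; have n1 : n.+1%:R^-1 <= 1 :> R.
  by rewrite invf_le1// ler1n.
have := ler_norm a; have := ler_norm b; have := ler_norm (- a).
have := ler_norm (- b); rewrite !normrN => h1 h2 h3 h4.
have [x0|x0] := leP 0 x.
  rewrite (ger0_norm x0) => hx; rewrite !ramp_ge ?subrr//;
  have := normr_ge0 a; have := normr_ge0 b; move: n1; set i := _^-1; lra.
rewrite (ltr0_norm x0) => hx; rewrite !ramp_le ?subrr//;
have := normr_ge0 a; have := normr_ge0 b; lra.
Qed.

Lemma derive_ramps n a b x : derive1 (fun x => ramp n a x - ramp n b x) x =
  derive1 (ramp n a) x - derive1 (ramp n b) x.
Proof.
have [[ha _] [hb _]] := (@smooth_ramp n a 0%N, @smooth_ramp n b 0%N).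
by rewrite !derive1E deriveB.
Qed.

Lemma ramp_cvg a x : ramp n a x @[n --> \oo] --> (if a < x then 1 else 0 : R).
Proof.
case: ltP => ax; last by under eq_cvg do rewrite ramp_le//; exact: cvg_cst.
have xa0 : 0 < x - a by rewrite subr_gt0.
apply: cvg_near_cst; near=> n; apply/ramp_ge; rewrite -lerBrDl ltW//.
near: n; exact: near_infty_natSinv_lt (PosNum xa0).
Unshelve. all: by end_near. Qed.

(** The difference of the two ramps is bounded by 1, supported between [a]
    and [b + 1], and converges pointwise to the indicator of [(a, b]]. *)
Lemma integral_ramps_cvg v a b : a < b -> mu.-integrable `[a, b + 1] (EFin \o v) ->
  \int[mu]_x (v x * (ramp n a x - ramp n b x)) @[n --> \oo] -->
  \int[mu]_(x in `]a, b]) v x.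
Proof.
move=> ab iv.
have mD : measurable (`[a, b + 1]%classic : set (measurableTypeR R)) by exact: measurable_itv.
have mv : measurable_fun `[a, b + 1] v by move/measurable_int/measurable_EFinP : iv.
have mr n c : measurable_fun (setT : set (measurableTypeR R)) (ramp n c).
  by apply: continuous_measurable_fun; exact/smooth_continuous/smooth_ramp.
have suppE n : \int[mu]_x (v x * (ramp n a x - ramp n b x)) =
    \int[mu]_(x in `[a, b + 1]) (v x * (ramp n a x - ramp n b x)).
  apply: Rintegral_support => x /= /negP; rewrite in_itv /= negb_and -!ltNge.
  have n1 : n.+1%:R^-1 <= 1 :> R by rewrite invf_le1// ler1n.
  case/orP => hx; first by rewrite !ramp_le ?subrr ?mulr0//; lra.
  by rewrite !ramp_ge ?subrr ?mulr0//; move: n1; set i := _^-1; lra.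
have supp : \int[mu]_(x in `]a, b]) v x =
    \int[mu]_(x in `[a, b + 1]) (v x * \1_(`]a, b]%classic) x).
  rewrite [LHS]Rintegral_mkcond [RHS]Rintegral_mkcond; congr Rintegral; apply/funext => x; rewrite !patchE.
  rewrite !mem_setE indicE mem_setE /=; case: ifPn; case: ifPn; rewrite ?mulr1 ?mulr0//.
  by rewrite !in_itv /= => /negP h /andP[h1 h2]; exfalso; apply: h; lra.
rewrite supp; under eq_fun do rewrite suppE.
have [|||||int2 _ c] := @dominated_convergence _ (measurableTypeR R) R mu _ mD
   (fun n x => (v x * (ramp n a x - ramp n b x))%:E)
   (fun x => (v x * \1_(`]a, b]%classic) x)%:E)
   (fun x => `|v x|%:E).
- move=> n; apply/measurable_EFinP; apply: measurable_funM => //.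
  apply: measurable_funTS; apply: measurable_funB; first exact: mr.
  exact: mr.
- apply/measurable_EFinP; exact: measurable_funM.
- apply: aeW => x _; apply: cvg_EFin; first by near=> n.
  apply: cvgM; first exact: cvg_cst.
  rewrite indicE mem_setE in_itv /=.
  rewrite (_ : _%:R = (if a < x then 1 else 0) - (if b < x then 1 else 0)); last first.
    by case: (ltP a x); case: (ltP b x) => //= h1 h2; rewrite ?subrr ?subr0//; lra.
  by apply: cvgB; exact: ramp_cvg.
- by move/integrable_norm : iv.
- apply: aeW => x n _; rewrite lee_fin normrM ler_piMr//.
  have /andP[h1 h2] := ramp01 n a x; have /andP[h3 h4] := ramp01 n b x.
  by rewrite ler_norml; lra.
have fin n : (\int[mu]_(x in `[a, (b + 1)%R])
    (v x * (ramp n a x - ramp n b x))%:E)%E \is a fin_num.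
  apply: integrable_fin_num => //.
  apply: (le_integrable mD _ _ iv).
    apply/measurable_EFinP; apply: measurable_funM => //.
    apply: measurable_funTS; apply: measurable_funB; first exact: mr.
  exact: mr.
  move=> x _; rewrite lee_fin normrM ler_piMr//.
  have /andP[h1 h2] := ramp01 n a x; have /andP[h3 h4] := ramp01 n b x.
  by rewrite ler_norml; lra.
apply: fine_cvg; rewrite fineK//; exact: integrable_fin_num.
Unshelve. all: by end_near. Qed.

(** Test with the difference of the ramps at [a] and [b]: its derivative
    tends to the difference of the point masses at [a] and [b], and the
    function itself to the indicator of [(a, b]]. *)
Lemma weak_FTC w v a b : continuous w ->
  (forall c d : R, mu.-integrable `[c, d] (EFin \o v)) ->
  (forall phi, test_function phi ->
    \int[mu]_x (w x * derive1 phi x) = - \int[mu]_x (v x * phi x)) ->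
  a < b -> \int[mu]_(x in `]a, b]) v x = w b - w a.
Proof.
move=> cw iv wv ab.
have h1 := integral_ramps_cvg ab (iv a (b + 1)).
have h2 := cvgB (ramp_approx_identity (a := b) cw) (ramp_approx_identity (a := a) cw).
have E n : \int[mu]_x (v x * (ramp n a x - ramp n b x)) =
    \int[mu]_x (w x * derive1 (ramp n b) x) -
    \int[mu]_x (w x * derive1 (ramp n a) x).
  rewrite -[LHS]opprK -wv; last exact: test_function_ramps.
  under [X in - X]eq_Rintegral do rewrite derive_ramps mulrBr.
  have ir c : mu.-integrable setT (EFin \o (fun x => w x * derive1 (ramp n c) x)).
    apply: (@integrable_support _ `[c, c + n.+1%:R^-1]); first exact: measurable_itv.
      by move=> x nA; rewrite derive_ramp0 ?mulr0// => h; apply: nA; rewrite /= in_itv.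
    apply: continuous_integrable_itv => x; apply: cvgM; first exact: cw.
    exact/smooth_continuous/smooth_derive/smooth_ramp.
  by rewrite RintegralB// opprB.
move: h1; under eq_fun do rewrite E; move=> h1.
by apply: (cvg_unique _ h1) => //; exact: h2.
Qed.

End WeakFTC.

(** * Square integrable functions, uniqueness and translations *)
Section SquareIntegrable.
Context {R : realType}.
Local Notation mu := (@lebesgue_measure R).
Implicit Types (u v w phi : R -> R) (a b c d h x : R).

Definition L2 u := measurable_fun setT u /\
  mu.-integrable setT (EFin \o (fun x => u x ^+ 2)).

Lemma L2_integrable_sq u : L2 u -> mu.-integrable setT (EFin \o (fun x => u x ^+ 2)).
Proof. by case. Qed.

Lemma normM_le_sq (p q : R) : `|p * q| <= p ^+ 2 + q ^+ 2.
Proof.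
rewrite normrM -(real_normK (num_real p)) -(real_normK (num_real q)).
by have := normr_ge0 p; have := normr_ge0 q; nra.
Qed.

Lemma L2_integrableM u v : L2 u -> L2 v ->
  mu.-integrable setT (EFin \o (fun x => u x * v x)).
Proof.
move=> [mu1 iu] [mv iv]; have := integrableD measurableT iu iv.
apply: le_integrable => //.
  by apply/measurable_EFinP; exact: measurable_funM.
move=> x _; rewrite lee_fin /= (ger0_norm (addr_ge0 (sqr_ge0 _) (sqr_ge0 _))).
exact: normM_le_sq.
Qed.

Lemma L2_lin u v (k : R) : L2 u -> L2 v -> L2 (fun x => k * u x + v x).
Proof.
move=> hu hv; have [mu1 iu] := hu; have [mv iv] := hv; split.
  by apply: measurable_funD => //; exact: measurable_funM.
have h1 := integrableZl measurableT (k ^+ 2) iu.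
have h2 := integrableZl measurableT (2 * k) (L2_integrableM hu hv).
have := integrableD measurableT (integrableD measurableT h1 h2) iv.
apply: eq_integrable => // x _ /=; rewrite -!EFinM -!EFinD; congr EFin; ring.
Qed.

Lemma continuous_support_L2 u a b : continuous u ->
  (forall x, ~ (a <= x <= b) -> u x = 0) -> L2 u.
Proof.
move=> cu hu; split; first exact: continuous_measurable_fun.
apply: (@integrable_support _ _ `[a, b]); first exact: measurable_itv.
  by move=> x nA; rewrite hu ?expr0n// => h; apply: nA; rewrite /= in_itv.
by apply: continuous_integrable_itv => x; apply: cvgM; exact: cu.
Qed.

Lemma L2_locally_integrable u a b : L2 u -> mu.-integrable `[a, b] (EFin \o u).
Proof.
move=> [mu1 iu].
have mab : measurable (`[a, b]%classic : set (measurableTypeR R)) by exact: measurable_itv.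
have h1 : mu.-integrable `[a, b] (EFin \o (fun x => u x ^+ 2)).
  by apply: integrableS iu.
have h2 : mu.-integrable `[a, b] (EFin \o (fun x : R => 1)).
  by apply: continuous_integrable_itv => x; exact: cvg_cst.
have := integrableD mab h1 h2; apply: le_integrable => //.
  by apply/measurable_EFinP; exact: measurable_funTS.
move=> x _; rewrite lee_fin /= (ger0_norm (addr_ge0 (sqr_ge0 _) ler01)).
by have := normM_le_sq (u x) 1; rewrite mulr1 expr1n.
Qed.

Lemma test_function_smooth phi : test_function phi -> smooth phi.
Proof. by case=> h _; exact/smoothP. Qed.

Lemma test_function_support phi : test_function phi ->
  exists M, forall x, ~ (- M <= x <= M) -> phi x = 0.
Proof.
case=> _ [M hM]; exists M => x hx; apply: hM; rewrite ltNge; apply/negP.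
by rewrite ler_norml.
Qed.

Lemma derive_support phi M : (forall x, ~ (- M <= x <= M) -> phi x = 0) ->
  forall x, ~ (- M <= x <= M) -> derive1 phi x = 0.
Proof.
move=> hM x hx; apply: (@derive1_cst_near _ _ _ 0).
have : x < - M \/ M < x.
  have [|h1] := ltP x (- M); first by left.
  by have [|h2] := ltP M x; [right|case: hx; rewrite h1].
case=> h; near=> y; apply: hM; apply/negP; rewrite negb_and -!ltNge; apply/orP.
- by left; near: y; exact: lt_nbhsl.
- by right; near: y; exact: lt_nbhsr.
Unshelve. all: by end_near. Qed.

Lemma test_function_derive phi : test_function phi -> test_function (derive1 phi).
Proof.
move=> h; split; first exact/smoothP/smooth_derive/test_function_smooth.
have [M /derive_support hM] := test_function_support h; exists M => x hx.
by apply: hM; rewrite -ler_norml; apply/negP; rewrite -ltNge.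
Qed.

Lemma test_function_derive1n phi n : test_function phi -> test_function (derive1n n phi).
Proof. by move=> h; elim: n => // n; rewrite derive1nS; exact: test_function_derive. Qed.

Lemma test_function_L2 phi : test_function phi -> L2 phi.
Proof.
move=> h; have [M hM] := test_function_support h.
by apply: continuous_support_L2 hM; exact/smooth_continuous/test_function_smooth.
Qed.

(** At a Lebesgue point, the value is the derivative of an indefinite
    integral, here the zero function. *)
Lemma vanishing_ae v : measurable_fun setT v ->
  (forall a b, mu.-integrable `[a, b] (EFin \o v)) ->
  (forall a b, a < b -> \int[mu]_(x in `]a, b]) v x = 0) ->
  {ae mu, forall x, v x = 0}.
Proof.
move=> mv iv v0.
have locv : locally_integrable setT v.
  split=> //; first exact: openT.
  move=> K _ cK; have [M [_ hM]] := compact_bounded cK.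
  have hK : K `<=` `[- (M + 1), M + 1].
    move=> x Kx; have := hM (M + 1); rewrite ltrDl => /(_ ltr01 x Kx) /=.
    by rewrite in_itv /= ler_norml.
  have /integrableP[_] := iv (- (M + 1)) (M + 1); apply: le_lt_trans.
  apply: ge0_subset_integral => //; first exact: compact_measurable.
  by apply/measurable_EFinP/measurable_funTS; apply: measurableT_comp.
have := lebesgue_differentiation locv.
apply: filterS; first exact: (ae_filter_ringOfSetsType mu).
move=> x hx.
have x1 : x < x + 1 by rewrite ltrDl.
have iv1 : mu.-integrable [set` Interval (BRight (x - 1)) (BRight (x + 1))] (EFin \o v).
  apply: integrableS (iv (x - 1) (x + 1)) => //.
  exact: subset_itv_oc_cc.
have [|_ <-] := FTC1_lebesgue_pt x1 iv1 _ hx.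
  by rewrite lte_fin ltrBlDr ltrDl.
apply: (@derive1_cst_near _ _ _ 0); near=> y.
by apply: v0; near: y; apply: lt_nbhsr; rewrite ltrBlDr ltrDl.
Unshelve. all: by end_near. Qed.

(** This is [weak_FTC] for the zero function, whose weak derivative is [v]. *)
Lemma du_Bois_Reymond v : measurable_fun setT v ->
  (forall a b, mu.-integrable `[a, b] (EFin \o v)) ->
  (forall phi, test_function phi -> \int[mu]_x (v x * phi x) = 0) ->
  {ae mu, forall x, v x = 0}.
Proof.
move=> mv iv h; apply: vanishing_ae => // a b ab.
have c0 : continuous (fun _ : R => 0 : R) by move=> x; exact: cvg_cst.
rewrite (weak_FTC c0 iv _ ab) ?subrr// => phi tphi.
rewrite h// oppr0; under eq_Rintegral do rewrite mul0r.
by rewrite Rintegral_cst// mul0r.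
Qed.

Let shiftR h (x : measurableTypeR R) : measurableTypeR R := x + h.

Let measurable_shiftR h : measurable_fun setT (shiftR h).
Proof. by apply: measurable_funD. Qed.

Lemma lebesgue_measure_shift h (A : set R) : measurable A ->
  pushforward mu (shiftR h) A = mu A.
Proof.
move=> mA; apply/esym/lebesgue_measure_unique => //= _ [[a b]] _ <-.
rewrite /pushforward (_ : _ @^-1` _ = `](a - h), (b - h)]%classic); last first.
  by apply/seteqP; split=> x /=; rewrite /shiftR !in_itv /= ltrBlDr lerBrDr.
rewrite !lebesgue_measure_itv/= !lte_fin ltrD2r.
by case: ifP => // _; rewrite -!EFinB; congr EFin; ring.
Qed.

Lemma ge0_integral_shift h (f : R -> \bar R) :
  measurable_fun setT f -> (forall x, 0 <= f x)%E ->
  (\int[mu]_x f (x + h)%R = \int[mu]_x f x)%E.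
Proof.
move=> mf f0.
transitivity (\int[pushforward mu (shiftR h)]_x f x)%E.
  by rewrite ge0_integral_pushforward//; exact: measurable_shiftR.
by apply: eq_measure_integral => A mA _; exact: lebesgue_measure_shift.
Qed.

Lemma Rintegral_shift h u : measurable_fun setT u ->
  \int[mu]_x u (x + h) = \int[mu]_x u x.
Proof.
move=> mu1; congr fine; rewrite [LHS]integralE [RHS]integralE.
have mu2 : measurable_fun setT (EFin \o u) by exact/measurable_EFinP.
have := ge0_integral_shift h (measurable_funepos mu2) (funepos_ge0 _).
have := ge0_integral_shift h (measurable_funeneg mu2) (funeneg_ge0 _).
move=> h1 h2; congr (_ - _)%E; [rewrite -h2|rewrite -h1]; apply: eq_integral => x _.
  by rewrite !funeposE.
by rewrite !funenegE.
Qed.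

Lemma measurable_shift h u : measurable_fun setT u ->
  measurable_fun setT (fun x => u (x + h)).
Proof. by move=> mu1; apply: (measurableT_comp mu1); exact: measurable_shiftR. Qed.

Lemma L2_shift h u : L2 u -> L2 (fun x => u (x + h)).
Proof.
move=> [mu1 /integrableP[m2 fin]]; split; first exact: measurable_shift.
apply/integrableP; split.
  apply/measurable_EFinP; apply: (@measurable_shift h (fun x => u x ^+ 2)).
  exact/measurable_EFinP.
rewrite (@ge0_integral_shift h (fun x => `|(u x ^+ 2)%:E|%E))//.
exact: measurableT_comp.
Qed.

Lemma derive1n_shift n h phi : smooth phi ->
  derive1n n (fun x => phi (x + h)) = (fun x => derive1n n phi (x + h)).
Proof.
elim: n phi => [//|n IH] phi sphi.
rewrite /derive1n !iterSr -/(derive1n n _) -/(derive1n n _).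
rewrite (_ : derive1 _ = (fun x => derive1 phi (x + h))); last first.
  apply: derive1_is => x.
  have hx := smooth_is_derive sphi (x + h).
  have ha : is_derive x 1 (fun x : R => x + h) 1.
    by apply: is_derive_eq; rewrite addr0.
  by have := @is_derive1_comp _ phi (fun y : R => y + h) x _ _ hx ha; rewrite mulr1.
by rewrite IH//; exact: smooth_derive.
Qed.

Lemma test_function_shift h phi : test_function phi ->
  test_function (fun x => phi (x + h)).
Proof.
move=> tphi; have sphi := test_function_smooth tphi.
have [_ [M hM]] := tphi; split.
  apply/smoothP => n; have := Cdiff_affine 1 h (sphi n).
  by rewrite (_ : (fun x => _) = (fun x => phi (x + h)))//; apply/funext => x; rewrite mul1r.
exists (M + `|h|) => x hx; apply: hM.
by rewrite -(ltrD2r `|h|) (lt_le_trans hx)// -[X in `|X| <= _](addrK h) ler_normB.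
Qed.

End SquareIntegrable.

(** * Real and imaginary parts *)
Section ComplexParts.
Context {R : realType}.
Implicit Types z w : R[i].

Lemma Re_mul z w :
  complex.Re (z * w) = complex.Re z * complex.Re w - complex.Im z * complex.Im w.
Proof. by case: z w => [a b] [c d]. Qed.

Lemma Im_mul z w :
  complex.Im (z * w) = complex.Re z * complex.Im w + complex.Im z * complex.Re w.
Proof. by case: z w => [a b] [c d]. Qed.

Lemma Re_add z w : complex.Re (z + w) = complex.Re z + complex.Re w.
Proof. by case: z w => [a b] [c d]. Qed.

Lemma Im_add z w : complex.Im (z + w) = complex.Im z + complex.Im w.
Proof. by case: z w => [a b] [c d]. Qed.

Lemma Re_opp z : complex.Re (- z) = - complex.Re z.
Proof. by case: z. Qed.

Lemma Im_opp z : complex.Im (- z) = - complex.Im z.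
Proof. by case: z. Qed.

Lemma Re_conjc z : complex.Re (conjc z) = complex.Re z.
Proof. by case: z. Qed.

Lemma Im_conjc z : complex.Im (conjc z) = - complex.Im z.
Proof. by case: z. Qed.

Lemma complex_ext z w : complex.Re z = complex.Re w -> complex.Im z = complex.Im w ->
  z = w.
Proof. by case: z w => [a b] [c d] /= -> ->. Qed.

Lemma Re_sum I (r : seq I) (P : pred I) (F : I -> R[i]) :
  complex.Re (\sum_(i <- r | P i) F i) = \sum_(i <- r | P i) complex.Re (F i).
Proof. by apply: (big_morph _ Re_add). Qed.

Lemma Im_sum I (r : seq I) (P : pred I) (F : I -> R[i]) :
  complex.Im (\sum_(i <- r | P i) F i) = \sum_(i <- r | P i) complex.Im (F i).
Proof. by apply: (big_morph _ Im_add). Qed.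

Lemma normc_sq z : Normc.normc z ^+ 2 = complex.Re z ^+ 2 + complex.Im z ^+ 2.
Proof. by case: z => a b /=; rewrite sqr_sqrtr// addr_ge0// sqr_ge0. Qed.

Lemma normc_ge0 z : 0 <= Normc.normc z.
Proof. by case: z => a b; exact: sqrtr_ge0. Qed.

Lemma Re_le_normc (z : R[i]) : `|complex.Re z| <= Normc.normc z.
Proof.
rewrite -(ler_pXn2r (ltn0Sn 1)) ?nnegrE ?normc_ge0// normc_sq.
by rewrite real_normK ?num_real// lerDl sqr_ge0.
Qed.

Lemma Im_le_normc (z : R[i]) : `|complex.Im z| <= Normc.normc z.
Proof.
rewrite -(ler_pXn2r (ltn0Sn 1)) ?nnegrE ?normc_ge0// normc_sq.
by rewrite real_normK ?num_real// lerDr sqr_ge0.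
Qed.

Definition partsE := (Re_mul, Im_mul, Re_add, Im_add, Re_opp, Im_opp, Re_conjc, Im_conjc).

End ComplexParts.

(** * Weak derivatives and the Sobolev form *)
Section WeakDerivatives.
Context {R : realType}.
Local Notation mu := (@lebesgue_measure R).
Implicit Types (f g : R -> R[i]) (phi psi : R -> R) (h x t : R) (k s : nat).

Lemma square_integrableP f : square_integrable f <->
  L2 (fun x => complex.Re (f x)) /\ L2 (fun x => complex.Im (f x)).
Proof.
have E : (fun x => (Normc.normc (f x) ^+ 2)%:E) =
    (fun x => (complex.Re (f x) ^+ 2 + complex.Im (f x) ^+ 2)%:E).
  by apply/funext => x; rewrite normc_sq.
split; last first.
  move=> [[m1 i1] [m2 i2]]; split=> //; rewrite E.
  have /integrableP[_] := integrableD measurableT i1 i2.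
  apply: le_lt_trans; rewrite le_eqVlt; apply/orP; left; apply/eqP.
  apply: eq_integral => x _; rewrite /= ger0_norm// addr_ge0// sqr_ge0//.
move=> [m1 m2]; rewrite E => fin.
have isum : mu.-integrable setT
    (EFin \o (fun x => complex.Re (f x) ^+ 2 + complex.Im (f x) ^+ 2)).
  apply/integrableP; split.
    apply/measurable_EFinP; apply: measurable_funD; exact: measurable_funX.
  apply: le_lt_trans fin; rewrite le_eqVlt; apply/orP; left; apply/eqP.
  apply: eq_integral => x _; rewrite /= ger0_norm// addr_ge0// sqr_ge0//.
split; (split; first by []).
- apply: le_integrable isum => //.
    apply/measurable_EFinP; exact: measurable_funX.
  move=> x _; rewrite lee_fin !ger0_norm ?addr_ge0 ?sqr_ge0//.
  by rewrite lerDl sqr_ge0.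
- apply: le_integrable isum => //.
    apply/measurable_EFinP; exact: measurable_funX.
  move=> x _; rewrite lee_fin !ger0_norm ?addr_ge0 ?sqr_ge0//.
  by rewrite lerDr sqr_ge0.
Qed.

Lemma cintegral_real_mul f phi : cintegral mu (fun x => f x * (phi x)%:C%C) =
  Complex (\int[mu]_x (complex.Re (f x) * phi x)) (\int[mu]_x (complex.Im (f x) * phi x)).
Proof.
by rewrite /cintegral; congr Complex; apply: eq_Rintegral => x _;
  rewrite partsE /= mulr0 ?subr0 ?add0r.
Qed.

Lemma weak_derivative_unique k f g1 g2 :
  square_integrable g1 -> square_integrable g2 ->
  weak_derivative k f g1 -> weak_derivative k f g2 ->
  {ae mu, forall x, g1 x = g2 x}.
Proof.
move=> /square_integrableP[r1 i1] /square_integrableP[r2 i2] w1 w2.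
have E phi : test_function phi ->
    \int[mu]_x (complex.Re (g1 x) * phi x) = \int[mu]_x (complex.Re (g2 x) * phi x) /\
    \int[mu]_x (complex.Im (g1 x) * phi x) = \int[mu]_x (complex.Im (g2 x) * phi x).
  move=> tphi; have := w2 _ tphi; rewrite w1// => /mulfI.
  rewrite signr_eq0 => /(_ isT).
  by rewrite !cintegral_real_mul => -[].
have main (u v : R -> R) : L2 u -> L2 v ->
    (forall phi, test_function phi ->
      \int[mu]_x (u x * phi x) = \int[mu]_x (v x * phi x)) ->
    {ae mu, forall x, u x = v x}.
  move=> hu hv huv.
  have hd := L2_lin (-1) hv hu.
  have : {ae mu, forall x, -1 * v x + u x = 0}.
    apply: du_Bois_Reymond.
    - by case: hd.
    - by move=> a b; apply: L2_locally_integrable.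
    - move=> phi tphi; have hp := test_function_L2 tphi.
      under eq_Rintegral do rewrite mulrDl mulN1r mulNr addrC.
      by rewrite RintegralB ?huv ?subrr//; exact: L2_integrableM.
  apply: filterS; first exact: (ae_filter_ringOfSetsType mu).
  by move=> x; rewrite mulN1r addrC => /subr0_eq.
have hr := main _ _ r1 r2 (fun p tp => (E p tp).1).
have hi := main _ _ i1 i2 (fun p tp => (E p tp).2).
move: hr hi; apply: filterS2; first exact: (ae_filter_ringOfSetsType mu).
by move=> x; exact: complex_ext.
Qed.

Lemma cintegral_shift h f :
  measurable_fun setT (fun x => complex.Re (f x)) ->
  measurable_fun setT (fun x => complex.Im (f x)) ->
  cintegral mu (fun x => f (x + h)) = cintegral mu f.
Proof.
move=> mr mi; rewrite /cintegral.
by rewrite (Rintegral_shift h mr) (Rintegral_shift h mi).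
Qed.

Lemma square_integrable_shift h f : square_integrable f ->
  square_integrable (fun x => f (x + h)).
Proof.
move=> /square_integrableP[r i]; apply/square_integrableP.
by split; [exact: (L2_shift h r)|exact: (L2_shift h i)].
Qed.

Lemma measurable_parts_mul f phi : square_integrable f -> test_function phi ->
  measurable_fun setT (fun x => complex.Re (f x * (phi x)%:C%C)) /\
  measurable_fun setT (fun x => complex.Im (f x * (phi x)%:C%C)).
Proof.
move=> [mr mi _] /test_function_L2[mp _]; split.
- rewrite (_ : (fun x => _) = (fun x => complex.Re (f x) * phi x)).
    exact: measurable_funM.
  by apply/funext => x; rewrite partsE /= mulr0 subr0.
- rewrite (_ : (fun x => _) = (fun x => complex.Im (f x) * phi x)).
    exact: measurable_funM.
  by apply/funext => x; rewrite partsE /= mulr0 add0r.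
Qed.

Lemma weak_derivative_shift h k f g :
  square_integrable f -> square_integrable g -> weak_derivative k f g ->
  weak_derivative k (fun x => f (x + h)) (fun x => g (x + h)).
Proof.
move=> sf sg w phi tphi.
pose psi x := phi (x + - h).
have tpsi : test_function psi := test_function_shift (- h) tphi.
have phiE : phi = fun x => psi (x + h).
  by apply/funext => x; rewrite /psi addrK.
have := w _ tpsi.
have [mr mi] := measurable_parts_mul sf (test_function_derive1n k tpsi).
rewrite -(cintegral_shift h mr mi).
have [mr' mi'] := measurable_parts_mul sg tpsi.
rewrite -(cintegral_shift h mr' mi').
by rewrite [in X in _ -> X]phiE (derive1n_shift k h (test_function_smooth tpsi)).
Qed.

Lemma wderiv_spec s f k : fs_mem (sobolev R s) f -> (k <= s)%N ->
  square_integrable (wderiv k f) /\ ((0 < k)%N -> weak_derivative k f (wderiv k f)).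
Proof.
case: k => [|k] [_ sf hf] ks; first by [].
by have [] := xgetPex (fun=> 0) (hf k.+1 ks).
Qed.

Lemma sobolev_shift s h f : fs_mem (sobolev R s) f ->
  fs_mem (sobolev R s) (fun x => f (x + h)).
Proof.
move=> [[cr ci] sf hf]; split.
- have cs : continuous (fun y : R => y + h).
    by move=> x; apply: cvgD; [exact: cvg_id|exact: cvg_cst].
  split=> x.
    exact: (@continuous_comp R R R (fun y => y + h) (fun y => complex.Re (f y)) x (cs x) (cr _)).
  exact: (@continuous_comp R R R (fun y => y + h) (fun y => complex.Im (f y)) x (cs x) (ci _)).
- exact: square_integrable_shift.
- move=> k /hf[g [sg wg]]; exists (fun x => g (x + h)); split.
    exact: square_integrable_shift.
  exact: weak_derivative_shift.
Qed.

Lemma sobolev_memE s f : fs_mem (sobolev R s) f <->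
  [/\ ccontinuous f, square_integrable f & forall k, (1 <= k <= s)%N ->
     exists g, square_integrable g /\ weak_derivative k f g].
Proof. by []. Qed.

(** The contribution of the [k]-th derivative to the squared Sobolev norm. *)
Definition energy k f := \int[mu]_x
  (complex.Re (wderiv k f x) * complex.Re (wderiv k f x) +
   complex.Im (wderiv k f x) * complex.Im (wderiv k f x)).

Lemma Re_sobolev_ip s f g : complex.Re (fs_ip (sobolev R s) f g) =
  \sum_(0 <= k < s.+1) \int[mu]_x
    (complex.Re (wderiv k f x) * complex.Re (wderiv k g x) +
     complex.Im (wderiv k f x) * complex.Im (wderiv k g x)).
Proof.
rewrite Re_sum; apply: eq_bigr => k _ /=; apply: eq_Rintegral => x _.
by rewrite !partsE mulrN opprK.
Qed.

Lemma Re_sobolev_sqnorm s f :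
  complex.Re (fs_ip (sobolev R s) f f) = \sum_(0 <= k < s.+1) energy k f.
Proof. exact: Re_sobolev_ip. Qed.

Lemma Im_sobolev_sqnorm s f : complex.Im (fs_ip (sobolev R s) f f) = 0.
Proof.
rewrite Im_sum big1// => k _ /=.
under eq_Rintegral do rewrite !partsE mulrN mulrC addrC subrr.
by rewrite Rintegral_cst// mul0r.
Qed.

Lemma energy_ge0 k f : 0 <= energy k f.
Proof.
by apply: Rintegral_ge0 => x _; rewrite addr_ge0// -expr2 sqr_ge0.
Qed.

(** [l a^2 + c^2 / l - 2 a c = (l a - c)^2 / l]. *)
Lemma young_pointwise (l a b c d : R) : 0 < l ->
  `|a * c + b * d| <= 2^-1 * (l * (a * a + b * b) + l^-1 * (c * c + d * d)).
Proof.
move=> l0; have il : l^-1 * l = 1 by rewrite mulVf// gt_eqF.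
have : 0 < l^-1 by rewrite invr_gt0.
move: (l^-1) il => i il i0.
have key (p q : R) : 2 * (p * q) <= l * (p * p) + i * (q * q).
  rewrite -subr_ge0.
  have -> : l * (p * p) + i * (q * q) - 2 * (p * q) =
      i * (l * p - q) ^+ 2 + (1 - i * l) * (l * (p * p) - 2 * (p * q)) by ring.
  by rewrite il subrr mul0r addr0 mulr_ge0 ?sqr_ge0 ?ltW.
have := key a c; have := key b d; have := key (- a) c; have := key (- b) d.
rewrite !mulrNN !mulNr !mulrN !mulrDr => h1 h2 h3 h4.
rewrite ler_norml; apply/andP; split; lra.
Qed.

Lemma L2_young (p1 p2 q1 q2 : R -> R) (l : R) : 0 < l ->
  L2 p1 -> L2 p2 -> L2 q1 -> L2 q2 ->
  `|\int[mu]_x (p1 x * q1 x + p2 x * q2 x)| <=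
  (l * \int[mu]_x (p1 x * p1 x + p2 x * p2 x) +
   l^-1 * \int[mu]_x (q1 x * q1 x + q2 x * q2 x)) / 2.
Proof.
move=> l0 hp1 hp2 hq1 hq2.
have iD (a1 b1 a2 b2 : R -> R) : L2 a1 -> L2 b1 -> L2 a2 -> L2 b2 ->
    mu.-integrable setT (EFin \o (fun x => a1 x * b1 x + a2 x * b2 x)).
  move=> h1 h2 h3 h4.
  exact: (integrableD measurableT (L2_integrableM h1 h2) (L2_integrableM h3 h4)).
have iZ (c : R) (u : R -> R) : mu.-integrable setT (EFin \o u) ->
    mu.-integrable setT (EFin \o (fun x => c * u x)).
  by move=> hu; exact: (integrableZl measurableT c hu).
have ip := iD _ _ _ _ hp1 hp1 hp2 hp2; have iq := iD _ _ _ _ hq1 hq1 hq2 hq2.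
have ipq := iD _ _ _ _ hp1 hq1 hp2 hq2.
apply: le_trans (le_normr_Rintegral measurableT ipq) _.
rewrite -(RintegralZl l measurableT ip) -(RintegralZl l^-1 measurableT iq).
rewrite -(RintegralD measurableT (iZ l _ ip) (iZ l^-1 _ iq)) mulrC.
have iS : mu.-integrable setT (EFin \o (fun x =>
    l * (p1 x * p1 x + p2 x * p2 x) + l^-1 * (q1 x * q1 x + q2 x * q2 x))).
  exact: (integrableD measurableT (iZ l _ ip) (iZ l^-1 _ iq)).
rewrite -(RintegralZl 2^-1 measurableT iS).
apply: le_Rintegral => //.
- exact: (integrable_norm ipq).
- exact: iZ.
- by move=> x _; exact: young_pointwise.
Qed.

(** Young's inequality under the integral.  Both sides involve the chosen
    weak derivatives of [f] and [g] only, so it holds before the form is known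
    to be linear. *)
Lemma sobolev_young s f g (l : R) : 0 < l ->
  fs_mem (sobolev R s) f -> fs_mem (sobolev R s) g ->
  `|complex.Re (fs_ip (sobolev R s) f g)| <=
  (l * complex.Re (fs_ip (sobolev R s) f f) +
   l^-1 * complex.Re (fs_ip (sobolev R s) g g)) / 2.
Proof.
move=> l0 hf hg; have transfer (a b c a' b' c' : R) : a = a' -> b = b' -> c = c' ->
    `|a'| <= (l * b' + l^-1 * c') / 2 -> `|a| <= (l * b + l^-1 * c) / 2.
  by move=> -> -> ->.
apply: (transfer _ _ _ _ _ _ (Re_sobolev_ip s f g) (Re_sobolev_ip s f f)
  (Re_sobolev_ip s g g)).
rewrite !mulr_sumr -big_split /= mulr_suml.
apply: le_trans (ler_norm_sum _ _ _) _.
rewrite big_nat_cond [leRHS]big_nat_cond; apply: ler_sum => k /andP[/andP[_ ks] _].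
have [/square_integrableP[rf jf] _] := wderiv_spec hf ks.
have [/square_integrableP[rg jg] _] := wderiv_spec hg ks.
exact: L2_young.
Qed.

Lemma energy_ae k f g : {ae mu, forall x, wderiv k f x = g x} ->
  square_integrable (wderiv k f) -> square_integrable g ->
  energy k f = \int[mu]_x (complex.Re (g x) * complex.Re (g x) +
     complex.Im (g x) * complex.Im (g x)).
Proof.
move=> h [m1 m2 _] [m3 m4 _]; congr fine; apply: ae_eq_integral => //.
- by apply/measurable_EFinP; apply: measurable_funD; exact: measurable_funM.
- by apply/measurable_EFinP; apply: measurable_funD; exact: measurable_funM.
- move: h; apply: filterS; first exact: (ae_filter_ringOfSetsType mu).
  by move=> x -> _.
Qed.

(** The chosen derivative of the translate need not be the translate of the
    chosen derivative, but the two agree almost everywhere. *)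
Lemma sobolev_sqnorm_shift s h f : fs_mem (sobolev R s) f ->
  complex.Re (fs_ip (sobolev R s) (fun x => f (x + h)) (fun x => f (x + h))) =
  complex.Re (fs_ip (sobolev R s) f f).
Proof.
move=> hf; have hsf := sobolev_shift h hf.
apply: etrans (Re_sobolev_sqnorm _ _) (etrans _ (esym (Re_sobolev_sqnorm _ _))).
apply: eq_big_nat => k /andP[_ ks].
have [sf wf] := wderiv_spec hf ks; have [ssf wsf] := wderiv_spec hsf ks.
rewrite (energy_ae (g := fun x => wderiv k f (x + h)))//; last first.
- exact: square_integrable_shift.
- case: k ks sf wf ssf wsf => [|k] ks sf wf ssf wsf; first exact: aeW.
  apply: (weak_derivative_unique ssf _ (wsf isT)).
    exact: square_integrable_shift.
  apply: weak_derivative_shift => //; last exact: wf.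
  by case: hf.
have [mr mi _] := sf.
apply: (Rintegral_shift h (u := fun x => complex.Re (wderiv k f x) * complex.Re (wderiv k f x) +
   complex.Im (wderiv k f x) * complex.Im (wderiv k f x))).
by apply: measurable_funD; exact: measurable_funM.
Qed.

End WeakDerivatives.

(** * Test functions belong to every Sobolev space *)
Section TestFunctions.
Context {R : realType}.
Local Notation mu := (@lebesgue_measure R).
Implicit Types (phi psi : R -> R) (f g : R -> R[i]) (s k : nat).

(** The integral of the derivative of the product vanishes, because the
    product does at both ends of a large interval. *)
Lemma test_function_parts phi psi : test_function phi -> test_function psi ->
  \int[mu]_x (phi x * derive1 psi x) = - \int[mu]_x (derive1 phi x * psi x).
Proof.
move=> tphi tpsi; have [M hM] := test_function_support tphi.
have sphi := test_function_smooth tphi; have spsi := test_function_smooth tpsi.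
have cphi := smooth_continuous sphi; have cpsi := smooth_continuous spsi.
have cphi' := smooth_continuous (smooth_derive sphi).
have cpsi' := smooth_continuous (smooth_derive spsi).
pose N : R := `|M| + 1.
have N0 : 0 < N by rewrite /N ltr_wpDl.
have hN (x : R) : ~ (- N < x < N) -> phi x = 0.
  move=> hx; apply: hM => /andP[h1 h2]; apply: hx.
  have := ler_norm M; rewrite /N => h; apply/andP; split; lra.
have i1 := L2_integrableM (test_function_L2 tphi) (test_function_L2 (test_function_derive tpsi)).
have i2 := L2_integrableM (test_function_L2 (test_function_derive tphi)) (test_function_L2 tpsi).
apply/eqP; rewrite -addr_eq0 -RintegralD//; apply/eqP.
have dM (x : R) : is_derive x 1 (fun y => phi y * psi y)
    (phi x * derive1 psi x + derive1 phi x * psi x).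
  have hd := is_deriveM (smooth_is_derive sphi x) (smooth_is_derive spsi x).
  by apply: (is_derive_eq hd); rewrite /GRing.scale /= (mulrC (psi x)).
have cM : continuous (fun y => phi y * psi y) by move=> x; apply: cvgM; [exact: cphi|exact: cpsi].
rewrite (@Rintegral_support _ _ `[- N, N]); last first.
  move=> x hx; have h' : ~ (- N <= x <= N) by move=> h; apply: hx; rewrite /= in_itv.
  rewrite (derive_support (phi := phi) _ h') ?hN ?mul0r ?addr0//.
    by move=> /andP[h1 h2]; apply: h'; rewrite !ltW.
  move=> y hy; apply: hN => /andP[h1 h2]; apply: hy.
  by rewrite !ltW.
rewrite /Rintegral (@continuous_FTC2 _ _ (fun y => phi y * psi y)).
- by rewrite !hN ?ltxx ?andbF// !mul0r subee.
- by lra.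
- apply: continuous_subspaceT => x; apply: cvgD; apply: cvgM.
  + exact: cphi.
  + exact: cpsi'.
  + exact: cphi'.
  + exact: cpsi.
- split; first by move=> x _; have [] := dM x.
  + by apply: cvg_at_right_filter; exact: cM.
  + by apply: cvg_at_left_filter; exact: cM.
- by move=> x _; rewrite (derive1_is dM).
Qed.

Lemma test_function_parts_n k phi psi : test_function phi -> test_function psi ->
  \int[mu]_x (phi x * derive1n k psi x) =
  (-1) ^+ k * \int[mu]_x (derive1n k phi x * psi x).
Proof.
elim: k phi => [|k IH] phi tphi tpsi; first by rewrite expr0 mul1r.
rewrite [derive1n k.+1 psi]derive1nS test_function_parts//; last exact: test_function_derive1n.
rewrite IH//; last exact: test_function_derive.
by rewrite exprS mulN1r mulNr /derive1n -iterSr.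
Qed.

Lemma Re_signM k (z : R[i]) : complex.Re ((-1) ^+ k * z) = (-1) ^+ k * complex.Re z.
Proof.
elim: k => [|k IH]; first by rewrite !expr0 !mul1r.
by rewrite !exprS -!mulrA !mulN1r -IH Re_opp.
Qed.

Lemma Im_signM k (z : R[i]) : complex.Im ((-1) ^+ k * z) = (-1) ^+ k * complex.Im z.
Proof.
elim: k => [|k IH]; first by rewrite !expr0 !mul1r.
by rewrite !exprS -!mulrA !mulN1r -IH Im_opp.
Qed.

Lemma Rintegral0 (D : set R) : \int[mu]_(x in D) (0 : R) = 0.
Proof. by rewrite /Rintegral integral0. Qed.

Lemma test_function_sobolev s phi : test_function phi ->
  fs_mem (sobolev R s) (fun x => (phi x)%:C%C).
Proof.
have L20 : L2 (fun _ : R => 0 : R).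
  by apply: (@continuous_support_L2 _ _ 0 0) => // x; exact: cvg_cst.
have sq psi : test_function psi -> square_integrable (fun x => (psi x)%:C%C).
  by move=> tpsi; apply/square_integrableP; split=> //=; exact: test_function_L2.
move=> tphi; apply/sobolev_memE; split.
- split=> /= x; last exact: cvg_cst.
  exact: smooth_continuous (test_function_smooth tphi) x.
- exact: sq.
- move=> k _; exists (fun x => (derive1n k phi x)%:C%C); split.
    exact/sq/test_function_derive1n.
  move=> psi tpsi; rewrite !cintegral_real_mul /=; apply: complex_ext.
    by rewrite Re_signM /= test_function_parts_n.
  rewrite Im_signM /=.
  by under eq_Rintegral do rewrite mul0r; under [in RHS]eq_Rintegral do rewrite mul0r;
    rewrite Rintegral0 mulr0.
Qed.

End TestFunctions.

(** * Kernels of translation invariant spaces *)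
Section TranslationInvariantKernel.
Context {R : realType}.
Implicit Types (V : funspace R R) (K : R -> R -> R[i]) (f g : R -> R[i]) (t h : R).

(** The Cauchy-Schwarz inequality in additive form; optimizing over [l] gives
    back the usual one. *)
Definition young_form V := forall (l : R) f g, 0 < l -> fs_mem V f -> fs_mem V g ->
  `|complex.Re (fs_ip V f g)| <=
  (l * complex.Re (fs_ip V f f) + l^-1 * complex.Re (fs_ip V g g)) / 2.

Definition translation_invariant V := forall h f, fs_mem V f ->
  fs_mem V (fun x => f (x + h)) /\
  complex.Re (fs_ip V (fun x => f (x + h)) (fun x => f (x + h))) =
  complex.Re (fs_ip V f f).

Section OneKernel.
Variables (V : funspace R R) (K : R -> R -> R[i]).
Hypotheses (yV : young_form V) (rkK : reproducing_kernel V K).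

Lemma kernel_diagE t : K t t = fs_ip V (K ^~ t) (K ^~ t).
Proof. exact: rkK.2 (rkK.1 t). Qed.

Lemma eval_bound (l : R) f t : 0 < l -> fs_mem V f ->
  `|complex.Re (f t)| <=
  (l * complex.Re (fs_ip V f f) + l^-1 * complex.Re (K t t)) / 2.
Proof.
by move=> l0 hf; rewrite kernel_diagE (rkK.2 f t hf); apply: yV => //; exact: rkK.1.
Qed.

Lemma eval_bound1 f t : fs_mem V f ->
  `|complex.Re (f t)| <= (complex.Re (fs_ip V f f) + complex.Re (K t t)) / 2.
Proof. by move=> hf; have := eval_bound t ltr01 hf; rewrite invr1 !mul1r. Qed.

(** If [K(t,t)] vanished, [eval_bound] would read
    [|f(t)| <= l |f|^2 / 2], which fails for small [l]. *)
Lemma kernel_diag_pos f t : complex.Re (f t) != 0 -> fs_mem V f ->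
  0 <= complex.Re (fs_ip V f f) -> 0 <= complex.Re (K t t) -> 0 < complex.Re (K t t).
Proof.
move=> ft hf E0 K0; rewrite lt_def K0 andbT; apply/eqP => Kt.
set E := complex.Re (fs_ip V f f) in E0 *.
set a := `|complex.Re (f t)|; have a0 : 0 < a by rewrite normr_gt0.
have l0 : 0 < a / (E + 1) by rewrite divr_gt0//; lra.
have := eval_bound t l0 hf; rewrite Kt mulr0 addr0 -/a -/E.
rewrite ler_pdivlMr// mulrAC ler_pdivlMr; last by lra.
by nra.
Qed.

Hypothesis tV : translation_invariant V.

(** The translate of [K(.,a)] that takes the value [K(a,a)] at [b] still has
    squared norm [K(a,a)], so [eval_bound1] reads
    [K(a,a) <= (K(a,a) + K(b,b)) / 2]. *)
Lemma kernel_diag_le a b : complex.Re (K a a) <= complex.Re (K b b).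
Proof.
have [hf nf] := tV (a - b) (rkK.1 a).
have := eval_bound1 b hf; rewrite nf -kernel_diagE (addrC b) subrK => h.
have := ler_norm (complex.Re (K a a)); lra.
Qed.

Lemma kernel_diag t : complex.Re (K t t) = complex.Re (K 0 0).
Proof. by apply/le_anti; rewrite !kernel_diag_le. Qed.

Lemma kernel_le_diag x t : `|complex.Re (K x t)| <= complex.Re (K 0 0).
Proof.
have := eval_bound1 x (rkK.1 t).
by rewrite -kernel_diagE !kernel_diag => h; lra.
Qed.

Lemma kernel_diag_ge0 : 0 <= complex.Re (K 0 0).
Proof. exact: le_trans (normr_ge0 _) (kernel_le_diag 0 0). Qed.

End OneKernel.

(** Evaluate [K(.,t)] at [t] through the other kernel: the bound is
    [K(t,t) <= (K(t,t) + K'(t,t)) / 2]. *)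
Lemma kernel_diag_antitone V V' K K' t : young_form V' ->
  reproducing_kernel V K -> reproducing_kernel V' K' ->
  (forall f, fs_mem V f -> fs_mem V' f /\
    complex.Re (fs_ip V' f f) <= complex.Re (fs_ip V f f)) ->
  complex.Re (K t t) <= complex.Re (K' t t).
Proof.
move=> yV' rkK rkK' VV'; have [hf nf] := VV' _ (rkK.1 t).
have := eval_bound1 yV' rkK' t hf; rewrite -(kernel_diagE rkK) in nf.
have := ler_norm (complex.Re (K t t)); lra.
Qed.

End TranslationInvariantKernel.

(** * Diagonal values of the Sobolev kernels *)
Section SobolevKernel.
Context {R : realType}.
Implicit Types (f g : R -> R[i]) (K : nat -> R -> R -> R[i]) (s : nat).

Lemma sobolev_young_form s : young_form (sobolev R s).
Proof. by move=> l f g; exact: sobolev_young. Qed.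

Lemma sobolev_translation_invariant s : translation_invariant (sobolev R s).
Proof.
by move=> h f hf; split; [exact: sobolev_shift|exact: sobolev_sqnorm_shift].
Qed.

Lemma sobolev_sub s s' f : (s' <= s)%N -> fs_mem (sobolev R s) f ->
  fs_mem (sobolev R s') f /\
  complex.Re (fs_ip (sobolev R s') f f) <= complex.Re (fs_ip (sobolev R s) f f).
Proof.
move=> ss' [cf sf hf]; split.
  by split=> // k /andP[k1 ks]; apply: hf; rewrite k1 (leq_trans ks).
have transfer (a b a' b' : R) : a = a' -> b = b' -> a' <= b' -> a <= b.
  by move=> -> ->.
apply: (transfer _ _ _ _ (Re_sobolev_sqnorm s' f) (Re_sobolev_sqnorm s f)).
rewrite [leRHS](@big_cat_nat _ _ _ s'.+1)//= lerDl.
by apply: sumr_ge0 => k _; exact: energy_ge0.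
Qed.

Lemma sobolev_sqnorm_ge0 s f : 0 <= complex.Re (fs_ip (sobolev R s) f f).
Proof.
have transfer (a a' : R) : a = a' -> 0 <= a' -> 0 <= a by move=> ->.
apply: (transfer _ _ (Re_sobolev_sqnorm s f)).
by apply: sumr_ge0 => k _; exact: energy_ge0.
Qed.

Lemma sobolev_kernel_real s (K : R -> R -> R[i]) t :
  reproducing_kernel (sobolev R s) K -> complex.Im (K t t) = 0.
Proof. by move=> rkK; rewrite (kernel_diagE rkK); exact: Im_sobolev_sqnorm. Qed.

Lemma sobolev_kernel_diag_gt0 s (K : R -> R -> R[i]) :
  reproducing_kernel (sobolev R s) K -> 0 < complex.Re (K 0 0).
Proof.
move=> rkK.
(* The ramp at -2 has reached 1 at the origin, the one at 1 is still 0. *)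
pose phi x : R := ramp 0 (-2) x - ramp 0 1 x.
have tphi : test_function phi := test_function_ramps 0 (-2) 1.
have phi0 : phi 0 = 1.
  by rewrite /phi ramp_ge ?ramp_le ?subr0// invr1; lra.
apply: (kernel_diag_pos (@sobolev_young_form s) rkK _ (test_function_sobolev s tphi)).
- by rewrite /= phi0 oner_eq0.
- exact: sobolev_sqnorm_ge0.
- exact: kernel_diag_ge0 (@sobolev_young_form s) rkK (@sobolev_translation_invariant s).
Qed.

End SobolevKernel.

(** * The sharp bound in the first order space *)
Section HalfBound.
Context {R : realType}.
Local Notation mu := (@lebesgue_measure R).
Implicit Types (u v phi : R -> R) (a b c x : R).

(** The real parts of a function of the first order Sobolev space and of its
    weak derivative form such a pair. *)
Definition weak_pair u v := [/\ continuous u, L2 u, L2 v &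
  forall phi, test_function phi ->
    \int[mu]_x (u x * derive1 phi x) = - \int[mu]_x (v x * phi x)].

Lemma is_derive_expc c x :
  is_derive x 1 (fun y : R => expR (c * y + 0)) (c * expR (c * x + 0)).
Proof.
have ha : is_derive x 1 (fun y : R => c * y + 0) c.
  by apply: is_derive_eq; rewrite /GRing.scale /=; ring.
have := @is_derive1_comp _ expR (fun y : R => c * y + 0) x _ _ (is_derive_expR _) ha.
by rewrite mulrC.
Qed.

Lemma smooth_expc c : smooth (fun y : R => expR (c * y + 0)).
Proof. by move=> n; apply: Cdiff_affine; exact: Cdiff_expR. Qed.

Lemma test_function_mul_expc c phi : test_function phi ->
  test_function (fun y => expR (c * y + 0) * phi y).
Proof.
move=> [hphi [M hM]]; split.
  apply/smoothP => n; apply: CdiffM; first exact: smooth_expc.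
  by have /smoothP := hphi; apply.
by exists M => x /hM ->; rewrite mulr0.
Qed.

Lemma integrable_mul_expc c u a b : L2 u ->
  mu.-integrable `[a, b] (EFin \o (fun x => expR (c * x + 0) * u x)).
Proof.
move=> hu; have [mu1 iu] := hu.
have mab : measurable (`[a, b]%classic : set (measurableTypeR R)) by exact: measurable_itv.
have ce := smooth_continuous (@smooth_expc c).
have h1 : mu.-integrable `[a, b] (EFin \o (fun x => u x ^+ 2)).
  by apply: integrableS iu.
have h2 : mu.-integrable `[a, b] (EFin \o (fun x : R => expR (c * x + 0) ^+ 2)).
  by apply: continuous_integrable_itv => x; apply: cvgM; exact: ce.
have := integrableD mab h2 h1; apply: le_integrable => //.
  apply/measurable_EFinP; apply: measurable_funTS; apply: measurable_funM => //.
  exact: continuous_measurable_fun.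
move=> x _; rewrite lee_fin /= (ger0_norm (addr_ge0 (sqr_ge0 _) (sqr_ge0 _))).
exact: normM_le_sq.
Qed.

(** The function [exp(c x) u] has the weak derivative [exp(c x) (c u + v)],
    because [exp(c x) phi] is a test function whenever [phi] is.  The summand 0
    in the exponent fits the affine chain rule [Cdiff_affine]. *)
Lemma weak_FTC_expc u v c a b : weak_pair u v -> a < b ->
  \int[mu]_(x in `]a, b]) (expR (c * x + 0) * (c * u x + v x)) =
  expR (c * b + 0) * u b - expR (c * a + 0) * u a.
Proof.
move=> [cu hu hv huv] ab.
have ce := smooth_continuous (@smooth_expc c).
apply: (weak_FTC (w := fun x => expR (c * x + 0) * u x)) => //.
- by move=> x; apply: cvgM; [exact: ce|exact: cu].
- by move=> p q; apply: integrable_mul_expc; exact: L2_lin.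
move=> phi tphi.
have te := test_function_mul_expc c tphi.
have te' := test_function_mul_expc c (test_function_derive tphi).
have := huv _ te.
have dE x : derive1 (fun y => expR (c * y + 0) * phi y) x =
    c * (expR (c * x + 0) * phi x) + expR (c * x + 0) * derive1 phi x.
  have [_ hd] := is_deriveM (is_derive_expc c x) (smooth_is_derive (test_function_smooth tphi) x).
  rewrite derive1E [LHS]hd /GRing.scale /=; ring.
under eq_Rintegral do rewrite dE mulrDr mulrCA.
have i1 := L2_integrableM hu (test_function_L2 te).
have i2 := L2_integrableM hu (test_function_L2 te').
have i3 := L2_integrableM hv (test_function_L2 te).
rewrite RintegralD//; last exact: (integrableZl measurableT c i1).
rewrite (RintegralZl c measurableT i1) => E.
rewrite (_ : \int[mu]_x (_ * _) = \int[mu]_x (u x * (expR (c * x + 0) * derive1 phi x))); last first.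
  by apply: eq_Rintegral => x _; ring.
rewrite (_ : \int[mu]_x (_ * phi x) = \int[mu]_x
   (c * (u x * (expR (c * x + 0) * phi x)) + v x * (expR (c * x + 0) * phi x))); last first.
  by apply: eq_Rintegral => x _; ring.
rewrite RintegralD//; last exact: (integrableZl measurableT c i1).
rewrite (RintegralZl c measurableT i1).
by move: E; lra.
Qed.

Lemma integral_expc c a b : c != 0 -> a < b ->
  \int[mu]_(x in `]a, b]) (expR (c * x + 0)) =
  c^-1 * expR (c * b + 0) - c^-1 * expR (c * a + 0).
Proof.
move=> c0 ab; have ce := smooth_continuous (@smooth_expc c).
rewrite Rintegral_itv_obnd_cbnd; last first.
  apply: integrableS (continuous_integrable_itv a b ce) => //.
  exact: subset_itv_oc_cc.
have sF : smooth (fun x => c^-1 * expR (c * x + 0)).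
  by move=> n; apply: CdiffM; [exact: Cdiff_cst|exact: smooth_expc].
rewrite /Rintegral (@continuous_FTC2 _ _ (fun x => c^-1 * expR (c * x + 0)))//.
- exact: continuous_subspaceT.
- split; first by move=> x _; exact: smooth_derivable.
  + by apply: cvg_at_right_filter; exact: (smooth_continuous sF).
  + by apply: cvg_at_left_filter; exact: (smooth_continuous sF).
- move=> x _; have [_ hd] := is_deriveM (is_derive_cst (c^-1 : R) x 1) (is_derive_expc c x).
  rewrite derive1E [LHS]hd /GRing.scale /= mulr0 addr0 mulrA mulVf// mul1r//.
Qed.

(** Integrate [A c exp(c x) (c u + v) <= A^2 exp(2 c x) + (u^2 + v^2) / 2],
    where the difference of the sides is half a sum of two squares when
    [c^2 = 1].  It is used with [A = u(0)],
    for [c = -1] on the right of the origin and [c = 1] on the left. *)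
Lemma half_line_bound u v (A c a b : R) : weak_pair u v -> c ^+ 2 = 1 -> a < b ->
  A * c * (expR (c * b + 0) * u b - expR (c * a + 0) * u a) <=
  A ^+ 2 * (\int[mu]_(x in `]a, b]) expR (2 * c * x + 0)) +
  2^-1 * \int[mu]_(x in `]a, b]) (u x ^+ 2 + v x ^+ 2).
Proof.
move=> uv c1 ab; have [cu hu hv _] := uv.
rewrite -(weak_FTC_expc c uv ab).
have mab : measurable (`]a, b]%classic : set (measurableTypeR R)) by exact: measurable_itv.
have sub (f : R -> R) : mu.-integrable `[a, b] (EFin \o f) ->
    mu.-integrable `]a, b] (EFin \o f).
  move=> h; apply: (integrableS _ _ _ h) => //; exact: subset_itv_oc_cc.
have i1 := sub _ (integrable_mul_expc c a b (L2_lin c hu hv)).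
have i2 : mu.-integrable `]a, b] (EFin \o (fun x => expR (2 * c * x + 0))).
  by apply/sub/continuous_integrable_itv/smooth_continuous/smooth_expc.
have i3 : mu.-integrable `]a, b] (EFin \o (fun x => u x ^+ 2 + v x ^+ 2)).
  have := integrableD measurableT (L2_integrable_sq hu) (L2_integrable_sq hv).
  by apply: integrableS.
rewrite -(RintegralZl _ mab i1) -(RintegralZl _ mab i2) -(RintegralZl _ mab i3).
have i2' : mu.-integrable `]a, b] (EFin \o (fun x => A ^+ 2 * expR (2 * c * x + 0))).
  exact: (integrableZl mab _ i2).
have i3' : mu.-integrable `]a, b] (EFin \o (fun x => 2^-1 * (u x ^+ 2 + v x ^+ 2))).
  exact: (integrableZl mab _ i3).
rewrite -RintegralD//; apply: le_Rintegral => //.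
- exact: (integrableZl mab _ i1).
- exact: (integrableD mab i2' i3').
move=> x _.
have -> : expR (2 * c * x + 0) = expR (c * x + 0) ^+ 2.
  by rewrite -expRM_natl; congr expR; ring.
move: (expR _) (u x) (v x) => e p q.
rewrite -subr_ge0.
have -> : A ^+ 2 * e ^+ 2 + 2^-1 * (p ^+ 2 + q ^+ 2) - A * c * (e * (c * p + q)) =
  2^-1 * (A * e - p) ^+ 2 + 2^-1 * (c * A * e - q) ^+ 2 +
  (1 - c ^+ 2) * (A * e * p + 2^-1 * A ^+ 2 * e ^+ 2) by field.
by rewrite c1 subrr mul0r addr0 addr_ge0// mulr_ge0 ?sqr_ge0 ?invr_ge0.
Qed.

(** Adding the two half-line bounds on [(0, M]] and [(-M, 0]], the
    exponentials integrate to at most 1/2 each, so that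
    [2 u(0)^2 <= u(0)^2 + E / 2] up to a term of order [exp(-M)]. *)
Lemma weak_pair_bound u v (B E : R) : weak_pair u v -> 0 <= u 0 ->
  (forall x, `|u x| <= B) ->
  \int[mu]_x (u x ^+ 2 + v x ^+ 2) <= E -> u 0 ^+ 2 <= E / 2.
Proof.
move=> uv u0 uB hE; have [cu hu hv _] := uv.
set A := u 0.
have main (M : R) : 0 < M -> A ^+ 2 <= 2 * A * B * expR (- M) + E / 2.
  move=> M0.
  have M0' : - M < 0 by rewrite oppr_lt0.
  have c1 : (-1) ^+ 2 = 1 :> R by rewrite sqrrN expr1n.
  have h1 := half_line_bound A uv c1 M0.
  have h2 := half_line_bound A uv (c := 1) (expr1n _ 2) M0'.
  have n1 : (2 * -1 : R) != 0 by rewrite mulrN1 oppr_eq0.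
  have n2 : (2 * 1 : R) != 0 by rewrite mulr1.
  move: h1 h2; rewrite !integral_expc// !(mulr0, addr0, expR0, mulr1, mul1r).
  rewrite !(mulrN, mulNr, mulr1, mul1r, opprK) -/A.
  set I1 := \int[mu]_(x in _) _; set I2 := \int[mu]_(x in _) _ => h1 h2.
  have hI : I1 + I2 <= E.
    apply: le_trans hE; rewrite addrC /I1 /I2.
    have mI p q : measurable (`]p, q]%classic : set (measurableTypeR R)) by exact: measurable_itv.
    have i3 : mu.-integrable setT (EFin \o (fun x => u x ^+ 2 + v x ^+ 2)).
      exact: (integrableD measurableT (L2_integrable_sq hu) (L2_integrable_sq hv)).
    rewrite -Rintegral_setU//; first last.
    - apply/disj_setPLR => x /= ; rewrite !in_itv /= => /andP[_ x0] /andP[x1 _].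
      by move: x1; rewrite ltNge x0.
    - by apply: integrableS i3 => //; exact: measurableU.
    rewrite Rintegral_mkcond; apply: le_Rintegral => //.
    - rewrite -restrict_EFin -integrable_mkcond//; last exact: measurableU.
      by apply: integrableS i3 => //; exact: measurableU.
    - by move=> x _; rewrite patchE; case: ifPn => // _; rewrite addr_ge0 ?sqr_ge0.
  have uM := le_trans (ler_norm _) (uB M).
  have uM' := le_trans (ler_norm _) (uB (- M)).
  have e0 : 0 <= expR (- M) by exact: expR_ge0.
  have e2 : 0 <= expR (- (2 * M)) by exact: expR_ge0.
  have A2 : 0 <= A ^+ 2 by exact: sqr_ge0.
  have k1 : A * expR (- M) * u M <= A * expR (- M) * B by rewrite ler_wpM2l ?mulr_ge0.
  have k2 : A * expR (- M) * u (- M) <= A * expR (- M) * B by rewrite ler_wpM2l ?mulr_ge0.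
  have k3 : 0 <= A ^+ 2 * expR (- (2 * M)) by rewrite mulr_ge0.
  move: h1 h2; rewrite invrN; clear - hI k1 k2 k3.
  move: (expR (- M)) (expR (- (2 * M))) k1 k2 k3 => e e' k1 k2 k3.
  by move: (u M) (u (- M)) k1 k2 => p q k1 k2 h1 h2; lra.
rewrite leNgt; apply/negP => hlt.
set eta := A ^+ 2 - E / 2.
have eta0 : 0 < eta by rewrite subr_gt0.
have B0 : 0 <= B := le_trans (normr_ge0 _) (uB 0).
have C0 : 0 <= 2 * A * B by rewrite !mulr_ge0.
(* With this M, exp(M) >= 1 + M exceeds 2 A B / eta. *)
have M0 : 0 < 2 * A * B / eta + 1 by rewrite ltr_wpDl// divr_ge0// ltW.
have := main _ M0; rewrite -lerBlDr -/eta expRN ler_pdivlMr ?expR_gt0//.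
apply/negP; rewrite -ltNge.
apply: (@lt_le_trans _ _ (eta * (1 + (2 * A * B / eta + 1)))); last first.
  by rewrite ler_pM2l// expR_ge1Dx.
rewrite !mulrDr mulr1 (mulrCA eta) divff ?gt_eqF// mulr1.
lra.
Qed.

Lemma sobolev1_kernel_diag_le (K : R -> R -> R[i]) :
  reproducing_kernel (sobolev R 1) K -> complex.Re (K 0 0) <= 2^-1.
Proof.
move=> rkK.
have yV := @sobolev_young_form R 1; have tV := @sobolev_translation_invariant R 1.
have K0 := sobolev_kernel_diag_gt0 rkK.
have hf := rkK.1 0.
have [[cr _] _ _] := (sobolev_memE 1 _).1 hf.
have [/square_integrableP[ru iu] _] := wderiv_spec hf (isT : (0 <= 1)%N).
have [sv wv] := wderiv_spec hf (isT : (1 <= 1)%N).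
have /square_integrableP[rv iv] := sv.
have uv : weak_pair (fun x => complex.Re (K x 0))
    (fun x => complex.Re (wderiv 1 (K ^~ 0) x)).
  split=> // phi tphi; have := wv isT phi tphi.
  by rewrite !cintegral_real_mul expr1 mulN1r => -[].
have L2sq (p q : R -> R) : L2 p -> L2 q ->
    mu.-integrable setT (EFin \o (fun x => p x * p x + q x * q x)).
  move=> hp hq.
  exact: (integrableD measurableT (L2_integrableM hp hp) (L2_integrableM hq hq)).
have hE : \int[mu]_x (complex.Re (K x 0) ^+ 2 +
    complex.Re (wderiv 1 (K ^~ 0) x) ^+ 2) <= complex.Re (K 0 0).
  have -> : complex.Re (K 0 0) = energy 0 (K ^~ 0) + energy 1 (K ^~ 0).
    rewrite (kernel_diagE rkK); apply: etrans (Re_sobolev_sqnorm _ _) _.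
    by rewrite big_nat_recl// big_nat1.
  rewrite /energy -RintegralD//; try exact: L2sq.
  apply: le_Rintegral => //.
  - exact: (L2sq _ _ ru rv).
  - exact: (integrableD measurableT (L2sq _ _ ru iu) (L2sq _ _ rv iv)).
  move=> x _; rewrite /= !expr2 -!addrA lerD2l addrCA lerDl addr_ge0//;
  by rewrite -expr2 sqr_ge0.
have := weak_pair_bound uv (ltW K0) (kernel_le_diag yV rkK tV ^~ 0) hE.
by rewrite expr2 ler_pM2l.
Qed.

End HalfBound.

(** * Hilbert spaces of functions: representation and greedy points *)
Section HilbertFunctionSpace.
Context {R : realType} {X : Type}.
Variables (V : funspace R X).
Hypothesis hV : hilbert_funspace V.
Local Notation ip := (fs_ip V).
Local Notation mem := (fs_mem V).
Implicit Types (f g h : X -> R[i]) (a : R[i]).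

Definition lin a f g : X -> R[i] := fun x => a * f x + g x.
Definition sqn f : R := complex.Re (ip f f).

Lemma mem0 : mem (fun=> 0). Proof. by case: hV => -[]. Qed.

Lemma mem_lin a f g : mem f -> mem g -> mem (lin a f g).
Proof. by case: hV => -[_ h] _ _ _ _; exact: h. Qed.

Lemma ip_lin a f g h : mem f -> mem g -> mem h ->
  ip (lin a f g) h = a * ip f h + ip g h.
Proof. by case: hV => _ hl _ _ _; exact: hl. Qed.

Lemma ip_conj f g : mem f -> mem g -> ip g f = conjc (ip f g).
Proof. by case: hV => _ _ hc _ _; exact: hc. Qed.

Lemma ip_linr a f g h : mem f -> mem g -> mem h ->
  ip h (lin a f g) = conjc a * ip h f + ip h g.
Proof.
move=> hf hg hh; rewrite (ip_conj (mem_lin a hf hg) hh) ip_lin//.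
by rewrite (ip_conj hf hh) (ip_conj hg hh); apply: complex_ext; rewrite !partsE; ring.
Qed.

Lemma ip0l f : mem f -> ip (fun=> 0) f = 0.
Proof.
move=> hf; have := ip_lin (-1) hf hf hf.
rewrite mulN1r addNr => E; rewrite -[RHS]E; congr (ip _ f).
by apply/funext => x; rewrite /lin mulN1r addNr.
Qed.

Lemma sqn0 : sqn (fun=> 0) = 0.
Proof. by rewrite /sqn ip0l//; exact: mem0. Qed.

Lemma sqn_gt0 f : mem f -> f <> (fun=> 0) -> 0 < sqn f.
Proof.
by move=> hf f0; case: hV => _ _ _ h _; have := h f hf f0; rewrite ltcE => /andP[].
Qed.

Lemma sqn_ge0 f : mem f -> 0 <= sqn f.
Proof.
move=> hf; have [->|/(sqn_gt0 hf)/ltW//] := pselect (f = (fun=> 0)).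
by rewrite sqn0.
Qed.

Lemma sqn_lin a f g : mem f -> mem g ->
  sqn (lin a f g) = (complex.Re a ^+ 2 + complex.Im a ^+ 2) * sqn f
    + 2 * complex.Re (a * ip f g) + sqn g.
Proof.
move=> hf hg; rewrite /sqn ip_lin//; last exact: mem_lin.
rewrite !ip_linr// (ip_conj hf hg) !partsE.
have If : complex.Im (ip f f) = 0.
  by have := congr1 (@complex.Im R) (ip_conj hf hf); rewrite Im_conjc => h; lra.
rewrite If; ring.
Qed.

(** Expand the squared norm of [g - <g, f> f / |f|^2]. *)
Lemma cauchy_schwarz f g : mem f -> mem g ->
  Normc.normc (ip f g) ^+ 2 <= sqn f * sqn g.
Proof.
move=> hf hg; have [->|/(sqn_gt0 hf) f0] := pselect (f = (fun=> 0)).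
  by rewrite ip0l// sqn0 mul0r Normc.normc0 expr0n.
set z := ip f g; pose t := (sqn f)^-1.
have := sqn_ge0 (mem_lin (- (t%:C%C * conjc z)) hf hg).
rewrite sqn_lin// -/z normc_sq !partsE /=.
set x := complex.Re z; set y := complex.Im z => h.
have tf : t * sqn f = 1 by rewrite /t mulVf// gt_eqF.
have t0 : 0 < t by rewrite invr_gt0.
rewrite -(ler_pM2l t0) mulrA tf mul1r -subr_ge0; apply: le_trans h _.
rewrite le_eqVlt; apply/orP; left; apply/eqP; rewrite -/x -/y.
transitivity (t * (x ^+ 2 + y ^+ 2) * (t * sqn f) - 2 * t * (x ^+ 2 + y ^+ 2) + sqn g).
  by ring.
by rewrite tf; ring.
Qed.

Section Riesz.
Variables (S : (X -> R[i]) -> R[i]) (C : R).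
Hypothesis S_lin : forall a f g, mem f -> mem g -> S (lin a f g) = a * S f + S g.
Hypothesis S_bound : forall f, mem f -> Normc.normc (S f) ^+ 2 <= C * sqn f.

Let J f := sqn f - 2 * complex.Re (S f).

Let J_ge f : mem f -> - `|C| <= J f.
Proof.
move=> hf; have F0 := sqn_ge0 hf; rewrite /J.
have SB : Normc.normc (S f) ^+ 2 <= `|C| * sqn f.
  by apply: le_trans (S_bound hf) _; rewrite ler_wpM2r// ler_norm.
have := Re_le_normc (S f); rewrite ler_norml => /andP[_ qp].
have p0 := normc_ge0 (S f); have c0 := normr_ge0 C.
have : Normc.normc (S f) <= (sqn f + `|C|) / 2.
  rewrite -(ler_pXn2r (ltn0Sn 1)) ?nnegrE//; last first.
    by rewrite divr_ge0// addr_ge0.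
  apply: le_trans SB _; rewrite -subr_ge0.
  have -> : ((sqn f + `|C|) / 2) ^+ 2 - `|C| * sqn f = ((sqn f - `|C|) / 2) ^+ 2 by field.
  exact: sqr_ge0.
by lra.
Qed.

Let Jinf := inf (J @` [set f | mem f]).

Let J_has_inf : has_inf (J @` [set f | mem f]).
Proof.
split; first by exists (J (fun=> 0)), (fun=> 0) => //; exact: mem0.
by exists (- `|C|) => _ [f hf <-]; exact: J_ge.
Qed.

Let Jinf_le f : mem f -> Jinf <= J f.
Proof. by move=> hf; apply: ge_inf; [case: J_has_inf|exists f]. Qed.

(** If [f] minimizes [J] up to [eta], moving from [f] along [g] cannot lower
    [J] by more than [eta]; the best step along [g] lowers it by
    [|<g, f> - S g|^2 / |g|^2]. *)
Let near_minimizer (eta : R) f g : mem f -> mem g -> J f <= Jinf + eta ->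
  Normc.normc (ip g f - S g) ^+ 2 <= eta * sqn g.
Proof.
move=> hf hg Jf; have [->|/(sqn_gt0 hg) g0] := pselect (g = (fun=> 0)).
  have -> : S (fun=> 0) = 0.
    have := S_lin (-1) hf hf; rewrite mulN1r addNr => E; rewrite -[RHS]E; congr S.
    by apply/funext => x; rewrite /lin mulN1r addNr.
  by rewrite ip0l// subrr sqn0 mulr0 Normc.normc0 expr0n.
set w := ip g f - S g; pose t := (sqn g)^-1.
pose a := - (t%:C%C * conjc w).
have := Jinf_le (mem_lin a hg hf).
rewrite /J sqn_lin// S_lin// => hJ; move: Jf; rewrite /J => Jf.
have E : 2 * complex.Re (a * ip g f) - 2 * complex.Re (a * S g + S f) =
    2 * complex.Re (a * w) - 2 * complex.Re (S f).
  by rewrite /w mulrBr !(Re_add, Re_opp); ring.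
rewrite normc_sq; have tg : t * sqn g = 1 by rewrite /t mulVf// gt_eqF.
have t0 : 0 < t by rewrite invr_gt0.
rewrite -(ler_pM2l t0) (mulrCA t eta) tg mulr1.
have Ea : complex.Re a ^+ 2 + complex.Im a ^+ 2 =
    t ^+ 2 * (complex.Re w ^+ 2 + complex.Im w ^+ 2).
  by rewrite /a !partsE /=; ring.
have Eaw : complex.Re (a * w) = - t * (complex.Re w ^+ 2 + complex.Im w ^+ 2).
  by rewrite /a !partsE /=; ring.
rewrite Ea in hJ; rewrite Eaw in E.
move: hJ E Jf; set W := _ ^+ 2 + _ ^+ 2.
have -> : t ^+ 2 * W * sqn g = t * W * (t * sqn g) by ring.
rewrite tg mulr1 => hJ E Jf; lra.
Qed.

Let delta (n : nat) : R := n.+1%:R^-1.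

Let delta_gt0 n : 0 < delta n. Proof. by rewrite invr_gt0. Qed.

Let minimizing_seq : exists u : nat -> X -> R[i], forall n,
  mem (u n) /\ forall g, mem g ->
    Normc.normc (ip g (u n) - S g) <= delta n * Num.sqrt (sqn g).
Proof.
have H n : exists f, mem f /\ J f <= Jinf + delta n ^+ 2.
  have d2 : 0 < delta n ^+ 2 by rewrite exprn_gt0.
  have [_ [f hf <-] hlt] := inf_adherent d2 J_has_inf.
  by exists f; split=> //; exact: ltW.
have [u hu] := choice H; exists u => n; have [un Jn] := hu n; split=> // g hg.
rewrite -(ler_pXn2r (ltn0Sn 1)) ?nnegrE ?normc_ge0//; last first.
  by rewrite mulr_ge0 ?sqrtr_ge0// ltW.
by rewrite exprMn sqr_sqrtr ?sqn_ge0//; exact: near_minimizer.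
Qed.

(** Two near minimizers represent [S] up to errors proportional to [|g|].
    Applied to [g] their difference, this bounds [|g|^2] by a small multiple of
    [|g|], so near minimizers form a Cauchy sequence; its limit represents [S]. *)
Lemma riesz_representation : exists2 h, mem h & forall f, mem f -> S f = ip f h.
Proof.
have [u hu] := minimizing_seq.
have um n : mem (u n) := (hu n).1.
have lE f g : (fun x => f x - g x) = lin (-1) g f.
  by apply/funext => x; rewrite /lin mulN1r addrC.
have md m n : mem (lin (-1) (u n) (u m)) by exact: mem_lin.
have cauchy m n : fs_norm V (lin (-1) (u n) (u m)) <= delta m + delta n.
  set g := lin _ _ _; set G := sqn g.
  have G0 : 0 <= G := sqn_ge0 (md m n).
  rewrite /fs_norm -/(sqn g) -/G.
  have key : G <= (delta m + delta n) * Num.sqrt G.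
    have EG : G = complex.Re (ip g (u m) - S g) - complex.Re (ip g (u n) - S g).
      rewrite /G /sqn {2}/g ip_linr//; last exact: md.
      by rewrite !partsE /=; ring.
    have := Re_le_normc (ip g (u m) - S g); have := Re_le_normc (ip g (u n) - S g).
    rewrite !ler_norml => /andP[h1 _] /andP[_ h2].
    have := (hu m).2 g (md m n); have := (hu n).2 g (md m n).
    by rewrite -/G mulrDl => h3 h4; rewrite [X in X <= _]EG; lra.
  have [G00|G00] := eqVneq G 0; first by rewrite G00 sqrtr0 addr_ge0// ltW.
  have sG : 0 < Num.sqrt G by rewrite sqrtr_gt0 lt_def G00.
  by rewrite -(ler_pM2r sG) -expr2 sqr_sqrtr.
have [h hm hcv] : exists2 f, mem f &
    fs_norm V (fun x => u n x - f x) @[n --> \oo] --> (0 : R).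
  case: hV => _ _ _ _; apply => // e e0.
  have e20 : 0 < e / 2 by rewrite divr_gt0.
  have [N _ hN] : \forall n \near \oo, delta n < e / 2.
    exact: near_infty_natSinv_lt (PosNum e20).
  exists N => m n Nm Nn; rewrite lE; apply: le_lt_trans (cauchy m n) _.
  by have := hN _ Nm; have := hN _ Nn; rewrite /=; lra.
exists h => // f hf.
have bound n : Normc.normc (S f - ip f h) <=
    Num.sqrt (sqn f) * (delta n + fs_norm V (fun x => u n x - h x)).
  rewrite lE; have mh := mem_lin (-1) hm (um n).
  have -> : S f - ip f h = - (ip f (u n) - S f) + ip f (lin (-1) h (u n)).
    by rewrite ip_linr//; apply: complex_ext; rewrite !partsE /=; ring.
  apply: le_trans (le_normcD _ _) _; rewrite normcN mulrDr; apply: lerD.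
    by rewrite mulrC; exact: (hu n).2.
  rewrite -(ler_pXn2r (ltn0Sn 1)) ?nnegrE ?normc_ge0//; last first.
    by rewrite mulr_ge0 ?sqrtr_ge0.
  rewrite exprMn /fs_norm -/(sqn _) (sqr_sqrtr (sqn_ge0 hf)) (sqr_sqrtr (sqn_ge0 mh)).
  exact: cauchy_schwarz.
have lim0 : Num.sqrt (sqn f) * (delta n + fs_norm V (fun x => u n x - h x))
    @[n --> \oo] --> Num.sqrt (sqn f) * (0 + 0).
  apply: cvgM; first exact: cvg_cst.
  by apply: cvgD => //; exact: cvg_harmonic.
have : Normc.normc (S f - ip f h) <= 0.
  rewrite addr0 mulr0 in lim0.
  have cst_cvg : (fun _ : nat => Normc.normc (S f - ip f h)) @ \oo -->
    Normc.normc (S f - ip f h) by exact: cvg_cst.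
  by apply: (ler_cvg_to cst_cvg lim0); near=> n; exact: bound.
move=> n0; apply/eqP; rewrite -subr_eq0; apply/eqP/Normc.eq0_normc/eqP.
by rewrite eq_le n0 normc_ge0.
Unshelve. all: by end_near. Qed.

End Riesz.

Section GreedyPoints.
Variables (K : X -> X -> R[i]) (S : (X -> R[i]) -> R[i]) (C k0 : R).
Hypothesis rkK : reproducing_kernel V K.
Hypothesis Kdiag : forall t, complex.Re (K t t) <= k0.
Hypothesis S_lin : forall a f g, mem f -> mem g -> S (lin a f g) = a * S f + S g.
Hypothesis S_bound : forall f, mem f -> Normc.normc (S f) ^+ 2 <= C * sqn f.
Hypothesis S_mean : forall f, mem f -> exists x, complex.Re (f x) <= complex.Re (S f).

Lemma sqn_kernel t : sqn (K ^~ t) = complex.Re (K t t).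
Proof. by rewrite /sqn -(rkK.2 _ t (rkK.1 t)). Qed.

Lemma eval_cauchy_schwarz f t : mem f ->
  Normc.normc (f t) ^+ 2 <= k0 * sqn f.
Proof.
move=> hf; rewrite (rkK.2 f t hf) mulrC.
apply: le_trans (cauchy_schwarz hf (rkK.1 t)) _.
by rewrite ler_wpM2l ?sqn_ge0// sqn_kernel.
Qed.

(** The residual [r] is carried along through its inner products with all
    [f].  The next point comes from [S_mean] for [r - h]: at a point where
    [r - h] is at most its mean, adding [K(.,x) - h] raises the squared norm by
    at most [K(x,x) - |h|^2]. *)
Lemma greedy_residual n : exists s : seq X, size s = n /\
  exists r, [/\ mem r, sqn r <= n%:R * k0 &
    forall f, mem f -> ip f r = \sum_(t <- s) f t - n%:R * S f].
Proof.
have [h hm Sh] := riesz_representation S_lin S_bound.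
elim: n => [|n [s [ss [r [rm rn rf]]]]].
  exists [::]; split=> //; exists (fun=> 0); split; first exact: mem0.
    by rewrite sqn0 mul0r.
  by move=> f hf; rewrite big_nil mul0r subr0 (ip_conj mem0 hf) ip0l// conjc0.
have [x hx] := S_mean (mem_lin (-1) hm rm).
exists (x :: s); split; first by rewrite /= ss.
have kx := rkK.1 x.
pose q := lin (-1) h (K ^~ x); have qm : mem q by exact: mem_lin.
exists (lin 1 q r); split; first exact: mem_lin.
  rewrite sqn_lin//= expr1n expr0n /= addr0 !mul1r.
  have -> : ip q r = conjc (r x) - conjc (S r).
    rewrite (ip_conj rm qm) /q ip_linr// -Sh// -(rkK.2 r x rm).
    by apply: complex_ext; rewrite !partsE /=; ring.
  have sq : sqn q = sqn h - 2 * complex.Re (h x) + complex.Re (K x x).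
    rewrite /q sqn_lin// sqn_kernel -(rkK.2 h x hm) !partsE /=; ring.
  have Shh : complex.Re (S h) = sqn h by rewrite Sh.
  move: hx; rewrite (S_lin (-1) hm rm) /lin !partsE sq /= => hx.
  have := Kdiag x; have := sqn_ge0 hm.
  rewrite -natr1 mulrDl mul1r; lra.
move=> f hf; rewrite big_cons ip_linr// rf// /q ip_linr// -Sh// -(rkK.2 f x hf).
rewrite -natr1; apply: complex_ext; rewrite !partsE /=; ring.
Qed.

(** The error at [f] is [<f, r> / n], and [|r| / n <= sqrt (n k0) / n]. *)
Lemma greedy_points n : (0 < n)%N -> exists x : 'I_n -> X,
  forall f, mem f -> sqn f <= 1 ->
    Normc.normc (S f - n%:R^-1 * \sum_(j < n) f (x j)) <= Num.sqrt k0 / Num.sqrt n%:R.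
Proof.
move=> n0; have [s [ss [r [rm rn rf]]]] := greedy_residual n.
have {ss}ss : size s == n by apply/eqP.
exists (tnth (Tuple ss)) => f hf f1.
have -> : \sum_(j < n) f (tnth (Tuple ss) j) = \sum_(t <- s) f t.
  by rewrite [RHS](big_tuple _ _ (Tuple ss)).
have nC0 : (n%:R : R[i]) != 0 by rewrite pnatr_eq0 -lt0n.
have nR0 : 0 < n%:R :> R by rewrite ltr0n.
have k00 : 0 <= k0.
  by have := le_trans (sqn_ge0 rm) rn; rewrite pmulr_rge0.
have -> : S f - n%:R^-1 * \sum_(t <- s) f t = - (n%:R^-1 * ip f r).
  by rewrite rf// mulrBr mulKf// opprB.
rewrite normcN Normc.normcM Normc.normcV.
have -> : Normc.normc (n%:R : R[i]) = n%:R.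
  have -> : (n%:R : R[i]) = (n%:R : R)%:C%C by rewrite rmorph_nat.
  by rewrite /= expr0n addr0 sqrtr_sqr ger0_norm.
have sn : 0 < Num.sqrt (n%:R : R) by rewrite sqrtr_gt0.
have En : n%:R = Num.sqrt n%:R * Num.sqrt n%:R :> R.
  by rewrite -expr2 sqr_sqrtr// ltW.
rewrite mulrC ler_pdivrMr// [X in _ * X]En mulrA divfK ?gt_eqF//.
rewrite -sqrtrM// -(ler_pXn2r (ltn0Sn 1)) ?nnegrE ?normc_ge0 ?sqrtr_ge0//.
rewrite sqr_sqrtr ?mulr_ge0//.
apply: le_trans (cauchy_schwarz hf rm) _; rewrite mulrC in rn.
apply: le_trans rn; rewrite -[leRHS]mul1r ler_wpM2r// sqn_ge0//.
Qed.

End GreedyPoints.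
End HilbertFunctionSpace.

(** * Integration against a probability density *)
Section DensityIntegral.
Context d (T : measurableType d) {R : realType} (mu : {measure set T -> \bar R}).
Variable rho : T -> R.
Hypotheses (mrho : measurable_fun setT rho) (rho0 : forall x, 0 <= rho x)
  (rho1 : (\int[mu]_x (rho x)%:E = 1)%E).
Implicit Types (u v : T -> R) (B : R).

Lemma integrable_density : mu.-integrable setT (EFin \o rho).
Proof.
apply/integrableP; split; first exact/measurable_EFinP.
rewrite (eq_integral (fun x => (rho x)%:E)) ?rho1 ?ltry//.
by move=> x _; rewrite /= ger0_norm.
Qed.

Lemma Rintegral_density : \int[mu]_x rho x = 1.
Proof. by rewrite /Rintegral rho1. Qed.

Lemma integrable_bounded_density u B : measurable_fun setT u ->
  (forall x, `|u x| <= B) -> mu.-integrable setT (EFin \o (fun x => u x * rho x)).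
Proof.
move=> mu1 uB.
have := integrableZl measurableT B integrable_density.
apply: le_integrable => //.
  by apply/measurable_EFinP; exact: measurable_funM.
move=> x _; rewrite lee_fin !normrM ler_wpM2r//.
exact: le_trans (uB x) (ler_norm _).
Qed.

Lemma density_mean_bound u B : measurable_fun setT u ->
  (forall x, `|u x| <= B) -> `|\int[mu]_x (u x * rho x)| <= B.
Proof.
move=> mu1 uB; have iu := integrable_bounded_density mu1 uB.
apply: le_trans (le_normr_Rintegral measurableT iu) _.
rewrite -[leRHS]mulr1 -Rintegral_density.
rewrite -(RintegralZl B measurableT integrable_density).
apply: le_Rintegral => //.
- exact: (integrable_norm iu).
- exact: (integrableZl measurableT B integrable_density).
- by move=> x _; rewrite normrM (ger0_norm (rho0 x)) ler_wpM2r.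
Qed.

(** Otherwise [(u - c) rho], with [c] the mean, is nonnegative with integral 0,
    hence [rho] vanishes almost everywhere, against its total mass 1. *)
Lemma density_mean_attained u B : measurable_fun setT u ->
  (forall x, `|u x| <= B) -> exists x, u x <= \int[mu]_x (u x * rho x).
Proof.
move=> mu1 uB; apply: contrapT => hn.
set c := \int[mu]_x (u x * rho x) in hn.
have cu x : c < u x by rewrite ltNge; apply/negP => h; apply: hn; exists x.
have iu := integrable_bounded_density mu1 uB.
have ic := integrableZl measurableT c integrable_density.
have w0 : \int[mu]_x (u x * rho x - c * rho x) = 0.
  rewrite RintegralB// (RintegralZl c measurableT integrable_density).
  by rewrite Rintegral_density mulr1 subrr.
have iw : mu.-integrable setT (EFin \o (fun x => u x * rho x - c * rho x)).
  exact: (integrableB measurableT iu ic).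
have mw : measurable_fun setT (EFin \o (fun x => u x * rho x - c * rho x)).
  exact: measurable_int iw.
have : (\int[mu]_x `|(EFin \o (fun x => u x * rho x - c * rho x)%R) x| = 0)%E.
  have fw := integrable_fin_num measurableT iw.
  rewrite -[RHS](congr1 EFin w0) /Rintegral fineK//.
  apply: eq_integral => x _ /=; rewrite ger0_norm// -mulrBl mulr_ge0// subr_ge0.
  exact: ltW.
move=> /(ae_eq_integral_abs _ measurableT mw) aew.
have : (\int[mu]_x (rho x)%:E = \int[mu]_x (cst 0 x))%E.
  apply: ae_eq_integral => //; first exact/measurable_EFinP.
  apply: filterS aew => x /(_ I) /= [] /eqP; rewrite -mulrBl mulf_eq0 subr_eq0 gt_eqF//=.
  by move=> /eqP -> _.
by rewrite rho1 integral0 => /eqP; rewrite eqe oner_eq0.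
Qed.

Let S (f : T -> R[i]) := cintegral mu (fun x => f x * (rho x)%:C%C).

Let SE f : S f = Complex (\int[mu]_x (complex.Re (f x) * rho x))
  (\int[mu]_x (complex.Im (f x) * rho x)).
Proof.
by rewrite /S /cintegral; congr Complex; apply: eq_Rintegral => x _;
  rewrite !partsE /= mulr0 ?subr0 ?add0r.
Qed.

Definition bounded_measurable (f : T -> R[i]) B :=
  [/\ measurable_fun setT (fun x => complex.Re (f x)),
      measurable_fun setT (fun x => complex.Im (f x)) &
      forall x, Normc.normc (f x) <= B].

Let bmRe f B : bounded_measurable f B -> forall x, `|complex.Re (f x)| <= B.
Proof. by move=> [_ _ h] x; exact: le_trans (Re_le_normc _) (h x). Qed.

Let bmIm f B : bounded_measurable f B -> forall x, `|complex.Im (f x)| <= B.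
Proof. by move=> [_ _ h] x; exact: le_trans (Im_le_normc _) (h x). Qed.

Lemma density_functional_lin (a : R[i]) f g B B' :
  bounded_measurable f B -> bounded_measurable g B' ->
  S (lin a f g) = a * S f + S g.
Proof.
move=> hf hg; have [rf jf _] := hf; have [rg jg _] := hg.
have i1 := integrable_bounded_density rf (bmRe hf).
have i2 := integrable_bounded_density jf (bmIm hf).
have i3 := integrable_bounded_density rg (bmRe hg).
have i4 := integrable_bounded_density jg (bmIm hg).
have lin3 (p q : R) (u v w : T -> R) : mu.-integrable setT (EFin \o u) ->
    mu.-integrable setT (EFin \o v) -> mu.-integrable setT (EFin \o w) ->
    \int[mu]_x (p * u x + q * v x + w x) =
    p * \int[mu]_x u x + q * \int[mu]_x v x + \int[mu]_x w x.
  move=> hu hv hw.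
  have zu := integrableZl measurableT p hu; have zv := integrableZl measurableT q hv.
  rewrite RintegralD//; last exact: (integrableD measurableT zu zv).
  by rewrite RintegralD// !RintegralZl.
rewrite !SE; apply: complex_ext; rewrite !partsE /=.
- rewrite -mulNr -lin3//; apply: eq_Rintegral => x _; rewrite /lin !partsE; ring.
- rewrite -lin3//; apply: eq_Rintegral => x _; rewrite /lin !partsE; ring.
Qed.

Lemma density_functional_bound f B : 0 <= B -> bounded_measurable f B ->
  Normc.normc (S f) ^+ 2 <= 2 * B ^+ 2.
Proof.
move=> B0 hf; have [rf jf _] := hf; rewrite normc_sq SE /=.
have h1 := density_mean_bound rf (bmRe hf).
have h2 := density_mean_bound jf (bmIm hf).
rewrite mulr_natl mulr2n; apply: lerD.
- by rewrite -real_normK ?num_real// ler_pXn2r ?nnegrE.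
- by rewrite -real_normK ?num_real// ler_pXn2r ?nnegrE.
Qed.

Lemma density_functional_mean f B : bounded_measurable f B ->
  exists x, complex.Re (f x) <= complex.Re (S f).
Proof.
by move=> hf; have [rf _ _] := hf; rewrite SE; exact: density_mean_attained (bmRe hf).
Qed.

End DensityIntegral.

(** * Grid points and cubes in Euclidean space *)
Section EuclideanSpace.
Context {R : realType}.
Implicit Types (d n : nat).

Definition grid_round n (y : R) : R := (Num.floor (n.+1%:R * y))%:~R / n.+1%:R.

Lemma grid_round_cvg (y : R) : grid_round n y @[n --> \oo] --> y.
Proof.
apply/cvgrPdist_le => e e0; near=> n.
have ne : n.+1%:R^-1 < e by near: n; exact: near_infty_natSinv_lt (PosNum e0).
have n0 : 0 < n.+1%:R :> R by [].
rewrite /grid_round; set z := Num.floor _.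
have /andP[h1 h2] := floor_itv (n.+1%:R * y); rewrite -/z in h1 h2.
have -> : y - z%:~R / n.+1%:R = (n.+1%:R * y - z%:~R) / n.+1%:R.
  by rewrite mulrBl (mulrC n.+1%:R) mulfK// gt_eqF.
rewrite normrM (gtr0_norm (_ : 0 < n.+1%:R^-1)) ?invr_gt0//.
rewrite ger0_norm ?subr_ge0//; apply: le_trans (ltW ne).
rewrite ler_piMl ?invr_ge0// lerBlDl; apply: ltW.
by rewrite intrD addrC in h2; rewrite addrC.
Unshelve. all: by end_near. Qed.

Definition grid_point d n (x : Rpow R d) : Rpow R d :=
  [tuple grid_round n (tnth x j) : measurableTypeR R | j < d].

(** Such a function takes countably many values, each on a union of grid
    cells. *)
Lemma measurable_comp_grid_point d n (F : Rpow R d -> R) :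
  measurable_fun setT (fun x => F (grid_point n x)).
Proof.
move=> _ B mB; rewrite setTI.
pose cell (z : d.-tuple int) : set (Rpow R d) :=
  \bigcap_(j in [set: 'I_d]) ((fun x : Rpow R d => tnth x j) @^-1`
    [set y | Num.floor (n.+1%:R * y) = tnth z j]).
pose val (z : d.-tuple int) : Rpow R d :=
  [tuple (tnth z j)%:~R / n.+1%:R : measurableTypeR R | j < d].
rewrite (_ : _ @^-1` _ = \bigcup_(z : d.-tuple int)
    (if `[< B (F (val z)) >] then cell z else set0)); last first.
  apply/seteqP; split=> [x /= Bx|x [z _]].
  - exists [tuple Num.floor (n.+1%:R * tnth x j) | j < d] => //.
    rewrite (_ : val _ = grid_point n x); last first.
      by apply: eq_from_tnth => j; rewrite !tnth_mktuple.
    by rewrite asboolT// => j _ /=; rewrite tnth_mktuple.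
  - case: asboolP => // Bz cz /=; rewrite (_ : grid_point n x = val z)//.
    by apply: eq_from_tnth => j; rewrite !tnth_mktuple /grid_round (cz j I).
apply: countable_bigcupT_measurable; first exact: countableP.
move=> z; case: ifP => // _.
apply: fin_bigcap_measurable; first exact: finite_finset.
move=> j _; rewrite -[X in measurable X]setTI; apply: measurable_tnth => //.
rewrite (_ : [set y | _] = `[(tnth z j)%:~R / n.+1%:R, (tnth z j + 1)%:~R / n.+1%:R[%classic).
  exact: measurable_itv.
apply/seteqP; split=> y /=; rewrite in_itv /=.
- move=> <-; have /andP[h1 h2] := floor_itv (n.+1%:R * y).
  by rewrite ler_pdivrMr// ltr_pdivlMr// !(mulrC y) h1.
- rewrite ler_pdivrMr// ltr_pdivlMr// !(mulrC y) => h.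
  by apply: floor_def.
Qed.

Definition box d (e : R) : set (Rpow R d) := [set x | forall j, `|tnth x j| < e].
Arguments box : clear implicits.

Lemma box_cons_pair d e :
  @cons_pair R d @^-1` (box d.+1 e) = ball (0 : R) e `*` box d e.
Proof.
apply/seteqP; split=> -[a t] /=.
- move=> h; split.
    by have := h ord0; rewrite /cons_pair /= tnth0 /ball /= sub0r normrN.
  by move=> j; have := h (lift ord0 j); rewrite tnthS.
- move=> [ha ht] j; have [j'|] := unliftP ord0 j.
    by move=> ->; rewrite /cons_pair /= tnthS.
  by move=> ->; rewrite /cons_pair /= tnth0; move: ha; rewrite /ball /= sub0r normrN.
Qed.

Lemma measurable_box d e : measurable (box d e).
Proof.
rewrite (_ : box d e = \bigcap_(j in [set: 'I_d])
    ((fun x : Rpow R d => tnth x j) @^-1` (ball (0 : R) e))); last first.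
  apply/seteqP; split=> x /= h j => [_|]; first by rewrite /= /ball /= sub0r normrN.
  by have := h j I; rewrite /= /ball /= sub0r normrN.
apply: fin_bigcap_measurable; first exact: finite_finset.
move=> j _; rewrite -[X in measurable X]setTI; apply: measurable_tnth => //.
exact: measurable_ball.
Qed.

(** A cube in dimension [d + 1] is the product of a ball of the line and a
    cube in dimension [d]. *)
Lemma box_gt0 d e : 0 < e -> (0 < lebesgue_pow R d (box d e))%E.
Proof.
move=> e0; elim: d => [|d IH] /=.
  by rewrite /dirac indicE mem_set ?lte01// => -[].
rewrite /tuple_step /pushforward box_cons_pair.
rewrite product_measure1E//; first last.
- exact: measurable_box.
- exact: measurable_ball.
have e2 : (0 < (e *+ 2)%:E)%E by rewrite lte_fin mulrn_wgt0.
rewrite -(lebesgue_measure_ball (0 : R) (ltW e0)) in e2.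
by apply: mule_gt0; [exact: e2|exact: IH].
Qed.

End EuclideanSpace.
Arguments box {R} d e.

(** * Tensor product kernels *)
Section ComplexProducts.
Context {R : realType}.

Lemma complex_prod_cvg (I : eqType) (r : seq I) (F : nat -> I -> R[i]) (c : I -> R[i]) :
  (forall i, complex.Re (F n i) @[n --> \oo] --> complex.Re (c i)) ->
  (forall i, complex.Im (F n i) @[n --> \oo] --> complex.Im (c i)) ->
  (complex.Re (\prod_(i <- r) F n i) @[n --> \oo] --> complex.Re (\prod_(i <- r) c i)) /\
  (complex.Im (\prod_(i <- r) F n i) @[n --> \oo] --> complex.Im (\prod_(i <- r) c i)).
Proof.
move=> hr hi; elim: r => [|i r [IHr IHi]].
  rewrite big_nil; split; under eq_fun do rewrite big_nil; exact: cvg_cst.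
rewrite big_cons !partsE; split; under eq_fun do rewrite big_cons !partsE.
- by apply: cvgB; apply: cvgM.
- by apply: cvgD; apply: cvgM.
Qed.

End ComplexProducts.

Section TensorSpace.
Context {R : realType} (d : nat) (K1 : R -> R -> R[i]) (k : R).
Hypothesis k_gt0 : 0 < k.
Hypothesis K1_diag : forall t, K1 t t = k%:C%C.
Hypothesis K1_continuous : forall t, ccontinuous (K1 ^~ t).
Variable H : funspace R (Rpow R d).
Hypothesis H_rkhs : rkhs H (tensor_kernel K1).
Local Notation K := (@tensor_kernel R d K1).
Local Notation mu := (lebesgue_pow R d).
Local Notation k0 := (k ^+ d).
Implicit Types (f : Rpow R d -> R[i]) (x t : Rpow R d).

Let hH : hilbert_funspace H. Proof. by case: H_rkhs. Qed.
Let rkH : reproducing_kernel H K. Proof. by case: H_rkhs. Qed.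

Lemma tensor_kernel_diag x : K x x = k0%:C%C.
Proof.
rewrite /tensor_kernel (eq_bigr (fun=> k%:C%C)) ?prodr_const ?card_ord ?rmorphXn//.
Qed.

Lemma k0_gt0 : 0 < k0. Proof. by rewrite exprn_gt0. Qed.

(** Each factor converges to a diagonal value, by continuity of the
    one-dimensional kernel in its first argument. *)
Lemma tensor_kernel_cvg (x : nat -> Rpow R d) t :
  (forall j, tnth (x n) j @[n --> \oo] --> (tnth t j : R)) ->
  complex.Re (K (x n) t) @[n --> \oo] --> k0.
Proof.
move=> xt.
rewrite (_ : k0 = complex.Re (\prod_(j < d) K1 (tnth t j) (tnth t j))); last first.
  by have := tensor_kernel_diag t; rewrite /tensor_kernel => ->.
have [] // := complex_prod_cvg (index_enum 'I_d)
  (F := fun n j => K1 (tnth (x n) j) (tnth t j))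
  (c := fun j => K1 (tnth t j) (tnth t j)).
- move=> j; have [cr _] := K1_continuous (tnth t j).
  exact: (cvg_comp _ (fun y => complex.Re (K1 y (tnth t j))) (xt j) (cr (tnth t j))).
- move=> j; have [_ ci] := K1_continuous (tnth t j).
  exact: (cvg_comp _ (fun y => complex.Im (K1 y (tnth t j))) (xt j) (ci (tnth t j))).
Qed.

Lemma eval_le f x : fs_mem H f -> Normc.normc (f x) <= Num.sqrt (k0 * sqn H f).
Proof.
move=> hf; have F0 := sqn_ge0 hH hf; have k00 := ltW k0_gt0.
rewrite -(ler_pXn2r (ltn0Sn 1)) ?nnegrE ?normc_ge0 ?sqrtr_ge0//.
rewrite sqr_sqrtr ?mulr_ge0//; apply: (eval_cauchy_schwarz hH rkH) => // t.
by rewrite tensor_kernel_diag.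
Qed.

(** [|K(.,t) - K(.,x)|^2 = 2 k0 - 2 Re K(t,x)], as the diagonal is constant. *)
Lemma eval_diff_le f x t : fs_mem H f ->
  Normc.normc (f t - f x) <= Num.sqrt (sqn H f * (2 * k0 - 2 * complex.Re (K t x))).
Proof.
move=> hf; have kx := rkH.1 x; have kt := rkH.1 t.
have E : f t - f x = fs_ip H f (lin (-1) (K ^~ x) (K ^~ t)).
  rewrite (ip_linr hH)// -(rkH.2 f x hf) -(rkH.2 f t hf).
  by apply: complex_ext; rewrite !partsE /=; ring.
have E2 : sqn H (lin (-1) (K ^~ x) (K ^~ t)) = 2 * k0 - 2 * complex.Re (K t x).
  rewrite (sqn_lin hH)// !(sqn_kernel rkH) !tensor_kernel_diag -(rkH.2 _ t kx) !partsE /=.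
  by ring.
have g0 := sqn_ge0 hH (mem_lin hH (-1) kx kt).
rewrite -E2 E -(ler_pXn2r (ltn0Sn 1)) ?nnegrE ?normc_ge0 ?sqrtr_ge0//.
rewrite sqr_sqrtr; last by rewrite mulr_ge0// (sqn_ge0 hH hf).
exact: (cauchy_schwarz hH hf (mem_lin hH (-1) kx kt)).
Qed.

Lemma eval_grid_point_cvg f x : fs_mem H f ->
  Normc.normc (f (grid_point n x) - f x) @[n --> \oo] --> (0 : R).
Proof.
move=> hf.
have c1 : complex.Re (K (grid_point n x) x) @[n --> \oo] --> k0.
  apply: tensor_kernel_cvg => j.
  by under eq_fun do rewrite tnth_mktuple; exact: grid_round_cvg.
have c2 : Num.sqrt (sqn H f * (2 * k0 - 2 * complex.Re (K (grid_point n x) x)))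
    @[n --> \oo] --> Num.sqrt (sqn H f * (2 * k0 - 2 * k0)).
  apply: (cvg_comp _ Num.sqrt); last exact: sqrt_continuous.
  apply: cvgM; first exact: cvg_cst.
  by apply: cvgB; [exact: cvg_cst|apply: cvgM; [exact: cvg_cst|exact: c1]].
rewrite subrr mulr0 sqrtr0 in c2.
apply: (squeeze_cvgr _ (cvg_cst _) c2); near=> n.
by rewrite normc_ge0 eval_diff_le.
Unshelve. all: by end_near. Qed.

(** Elements of the space are pointwise limits of their values at grid
    points, by [eval_diff_le] and the continuity of the kernel. *)
Lemma mem_bounded_measurable f : fs_mem H f ->
  bounded_measurable f (Num.sqrt (k0 * sqn H f)).
Proof.
move=> hf; split; last by move=> x; exact: eval_le.
- apply: (measurable_fun_cvg (h := fun n x => complex.Re (f (grid_point n x)))).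
    by move=> n; exact: (measurable_comp_grid_point n (fun x => complex.Re (f x))).
  move=> x _; apply: cvg_sub0 (cvg_cst _); apply/norm_cvg0P.
  apply: (squeeze_cvgr _ (cvg_cst _) (eval_grid_point_cvg x hf)); near=> n.
  apply/andP; split; first exact: normr_ge0.
  by apply: le_trans (Re_le_normc _); rewrite Re_add Re_opp.
- apply: (measurable_fun_cvg (h := fun n x => complex.Im (f (grid_point n x)))).
    by move=> n; exact: (measurable_comp_grid_point n (fun x => complex.Im (f x))).
  move=> x _; apply: cvg_sub0 (cvg_cst _); apply/norm_cvg0P.
  apply: (squeeze_cvgr _ (cvg_cst _) (eval_grid_point_cvg x hf)); near=> n.
  apply/andP; split; first exact: normr_ge0.
  by apply: le_trans (Im_le_normc _); rewrite Im_add Im_opp.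
Unshelve. all: by end_near. Qed.

Lemma fs_normE f : fs_norm H f = Num.sqrt (sqn H f). Proof. by []. Qed.

Lemma qmc_points rho n : probability_density rho -> (0 < n)%N ->
  exists x : 'I_n -> Rpow R d,
    (qmc_error H rho x <= (Num.sqrt k0 / Num.sqrt n%:R)%:E)%E.
Proof.
move=> [mrho rho0 rho1] n0; have k00 := ltW k0_gt0.
have S_lin a f g : fs_mem H f -> fs_mem H g ->
    integration_problem rho (lin a f g) =
    a * integration_problem rho f + integration_problem rho g.
  move=> hf hg; exact: (density_functional_lin mrho rho0 rho1 a
    (mem_bounded_measurable hf) (mem_bounded_measurable hg)).
have S_bound f : fs_mem H f ->
    Normc.normc (integration_problem rho f) ^+ 2 <= (2 * k0) * sqn H f.
  move=> hf; have := density_functional_bound mrho rho0 rho1 (sqrtr_ge0 _)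
    (mem_bounded_measurable hf).
  by rewrite (sqr_sqrtr (mulr_ge0 k00 (sqn_ge0 hH hf))) mulrA.
have S_mean f : fs_mem H f -> exists x,
    complex.Re (f x) <= complex.Re (integration_problem rho f).
  by move=> hf; exact: (density_functional_mean mrho rho0 rho1 (mem_bounded_measurable hf)).
have Kd t : complex.Re (K t t) <= k0 by rewrite tensor_kernel_diag.
have [x hx] := greedy_points hH rkH Kd S_lin S_bound S_mean n0.
exists x; apply: ge_ereal_sup => _ [f [hf f1] <-].
rewrite lee_fin; apply: hx => //.
rewrite fs_normE in f1; rewrite -(sqr_sqrtr (sqn_ge0 hH hf)).
by rewrite -[leRHS](expr1n _ 2) ler_pXn2r ?nnegrE ?sqrtr_ge0.
Qed.

Lemma mu_setT_gt0 : (0 < mu [set: Rpow R d])%E.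
Proof.
apply: lt_le_trans (box_gt0 d (ltr01 : 0 < 1 :> R)) _.
by apply: le_measure => //; rewrite inE; [exact: measurable_box|exact: measurableT].
Qed.

Lemma Lnorm_le f (B : R) : (forall x, Normc.normc (f x) <= B) ->
  (Lnorm mu +oo (fun x => (Normc.normc (f x))%:E) <= B%:E)%E.
Proof.
move=> fB; rewrite unlock mu_setT_gt0; apply/ess_supP; apply: nearW => x /=.
by rewrite lee_fin ger0_norm// normc_ge0.
Qed.

Lemma kernel_near_origin (r : R) : r < k0 -> exists2 e : R, 0 < e &
  forall x, box d e x -> r < complex.Re (K x (origin R d)).
Proof.
move=> rk; apply: contrapT => hn.
have hx n : exists x, box d n.+1%:R^-1 x /\ complex.Re (K x (origin R d)) <= r.
  apply: contrapT => hx; apply: hn; exists n.+1%:R^-1 => // x bx.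
  by rewrite ltNge; apply/negP => h; apply: hx; exists x.
have [x {}hx] := choice hx.
have xt j : tnth (x n) j @[n --> \oo] --> (tnth (origin R d) j : R).
  rewrite tnth_mktuple; apply/norm_cvg0P.
  apply: (squeeze_cvgr _ (cvg_cst _) (@cvg_harmonic R)); near=> n.
  by rewrite normr_ge0 /= ltW//; have [bx _] := hx n; exact: bx.
have : k0 <= r.
  apply: (cvgr_to_le (tensor_kernel_cvg xt)); near=> n.
  by have [_] := hx n.
by rewrite leNgt rk.
Unshelve. all: by end_near. Qed.

(** A bound almost everywhere below [k0] would be violated on a cube around
    the origin. *)
Lemma Lnorm_kernel_ge :
  (k0%:E <= Lnorm mu +oo (fun x => (Normc.normc (K x (origin R d)))%:E))%E.
Proof.
rewrite unlock mu_setT_gt0 leNgt; apply/negP => hlt.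
have [r rk hr] : exists2 r : R, r < k0 & (ess_sup mu
    (abse \o (fun x => (Normc.normc (K x (origin R d)))%:E)) <= r%:E)%E.
  move: hlt; case: ess_sup => [r| |]; rewrite ?lte_fin//.
    by move=> rk; exists r.
  by move=> _; exists (k0 - 1); rewrite ?leNye// ltrBlDr ltrDl.
have [e e0 he] := kernel_near_origin rk.
have /ess_supP[N [mN N0 subN]] := hr.
have : (mu (box d e) <= mu N)%E.
  apply: le_measure; rewrite ?inE//; first exact: measurable_box.
  move=> x bx; apply: subN => /=; rewrite lee_fin ger0_norm ?normc_ge0// => h.
  have := lt_le_trans (he x bx) (le_trans (le_trans (ler_norm _) (Re_le_normc _)) h).
  by rewrite ltxx.
by rewrite N0 leNgt box_gt0.
Qed.

Lemma embedding_normE : embedding_norm H = (Num.sqrt k0)%:E.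
Proof.
have k00 := ltW k0_gt0.
apply/eqP; rewrite eq_le; apply/andP; split.
  apply: ge_ereal_sup => _ [f [hf f0] <-].
  have F0 := sqn_gt0 hH hf f0.
  have s0 : 0 < fs_norm H f by rewrite fs_normE sqrtr_gt0.
  apply: (@le_trans _ _ ((Num.sqrt (k0 * sqn H f))%:E * ((fs_norm H f)^-1)%:E)%E).
    apply: lee_wpmul2r; first by rewrite lee_fin invr_ge0 ltW.
    by apply: Lnorm_le => x; exact: eval_le.
  by rewrite -EFinM lee_fin fs_normE sqrtrM// mulfK// gt_eqF// sqrtr_gt0.
set f := K ^~ (origin R d).
have hf : fs_mem H f := rkH.1 _.
have sf : sqn H f = k0 by rewrite (sqn_kernel rkH) tensor_kernel_diag.
have f0 : f <> (fun=> 0).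
  by move=> h; have := sqn0 hH; rewrite -h sf => h'; have := k0_gt0; rewrite h' ltxx.
apply: le_trans (ereal_sup_ubound _); last by exists f.
rewrite fs_normE sf.
apply: (@le_trans _ _ (k0%:E * ((Num.sqrt k0)^-1)%:E)%E).
  rewrite -EFinM lee_fin -{2}(sqr_sqrtr k00) expr2 mulfK// gt_eqF//.
  by rewrite sqrtr_gt0 k0_gt0.
apply: lee_wpmul2r; first by rewrite lee_fin invr_ge0 sqrtr_ge0.
exact: Lnorm_kernel_ge.
Qed.

End TensorSpace.

(** * The error bound and tractability *)
Section SobolevTensor.
Context {R : realType}.
Implicit Types (s d n : nat).

Lemma sobolev_tensor_bounds s d (K : R -> R -> R[i]) :
  reproducing_kernel (sobolev R s) K ->
  forall H : funspace R (Rpow R d), rkhs H (tensor_kernel K) ->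
  let k := complex.Re (K 0 0) in
  [/\ tensor_kernel K (origin R d) (origin R d) = (k ^+ d)%:C%C,
      embedding_norm H = (Num.sqrt (k ^+ d))%:E &
      forall rho n, probability_density rho -> (0 < n)%N ->
      exists x : 'I_n -> Rpow R d,
        (qmc_error H rho x <= (Num.sqrt (k ^+ d) / Num.sqrt n%:R)%:E)%E].
Proof.
move=> rkK H rkH k.
have yV := @sobolev_young_form R s; have tV := @sobolev_translation_invariant R s.
have k_gt0 : 0 < k := sobolev_kernel_diag_gt0 rkK.
have Kd t : K t t = k%:C%C.
  by apply: complex_ext; [exact: kernel_diag yV rkK tV t|exact: sobolev_kernel_real rkK].
have Kc t : ccontinuous (K ^~ t).
  by have [] := (sobolev_memE s _).1 (rkK.1 t).
split.
- exact: tensor_kernel_diag.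
- exact: (embedding_normE k_gt0 Kd Kc rkH).
- by move=> rho n hrho n0; exact: (qmc_points k_gt0 Kd Kc rkH hrho n0).
Qed.

Lemma sobolev_kernel_diag_le_half s (K K' : R -> R -> R[i]) : (0 < s)%N ->
  reproducing_kernel (sobolev R s) K -> reproducing_kernel (sobolev R 1) K' ->
  complex.Re (K 0 0) <= complex.Re (K' 0 0) <= 2^-1.
Proof.
move=> s0 rkK rkK'; rewrite (sobolev1_kernel_diag_le rkK') andbT.
apply: (kernel_diag_antitone 0 (@sobolev_young_form R 1) rkK rkK') => f.
exact: sobolev_sub.
Qed.

Lemma information_complexity_le d (V : funspace R (Rpow R d)) rho n (eps : R)
    (x : 'I_n -> Rpow R d) :
  (qmc_error V rho x <= eps%:E)%E -> (information_complexity V rho eps <= n%:R%:E)%E.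
Proof.
move=> hx; apply: ereal_inf_lbound; exists n => //.
by exists x, (fun v => n%:R^-1 * \sum_(j < n) v j).
Qed.

End SobolevTensor.

Theorem mainTheorem5 (R : realType) (K1 : nat -> R -> R -> R[i])
    (K1_rk : forall s, (0 < s)%N -> reproducing_kernel (sobolev R s) (K1 s)) :
  (forall (s d : nat), (0 < s)%N -> (0 < d)%N ->
   forall H : funspace R (Rpow R d), rkhs H (@tensor_kernel R d (K1 s)) ->
   forall rho : Rpow R d -> R, probability_density rho ->
   forall n : nat, (0 < n)%N ->
   exists x : 'I_n -> Rpow R d,
     let k0 := complex.Re (tensor_kernel (K1 s) (origin R d) (origin R d)) in
     let k1 := fun r => complex.Re (K1 r 0 0) in
     let rn := Num.sqrt (n%:R : R) in
     [/\ (qmc_error H rho x <= embedding_norm H * (rn^-1)%:E)%E,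
         (embedding_norm H * (rn^-1)%:E = (k0 `^ 2^-1 / rn)%:E)%E,
         k0 `^ 2^-1 / rn = k1 s `^ (d%:R / 2) / rn,
         k1 s `^ (d%:R / 2) / rn <= k1 1%N `^ (d%:R / 2) / rn &
         k1 1%N `^ (d%:R / 2) / rn <= 2 `^ (- (d%:R / 2)) / rn]) /\
  (forall (s : nat -> nat) (H : forall d, funspace R (Rpow R d))
     (rho : forall d, Rpow R d -> R),
   (forall d, (0 < d)%N ->
      [/\ (0 < s d)%N, rkhs (H d) (@tensor_kernel R d (K1 (s d))) &
          probability_density (@rho d)]) ->
   strongly_polynomially_tractable H rho).
Proof.
have bounds := fun s d s0 => @sobolev_tensor_bounds R s d _ (K1_rk s s0).
split.
  move=> s d s0 d0 H rkH rho hrho n n0.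
  have [Kd emb pts] := bounds s d s0 H rkH.
  have [x hx] := pts rho n hrho n0; exists x.
  have [k1_le k_half] := andP (sobolev_kernel_diag_le_half s0 (K1_rk s s0) (K1_rk 1%N isT)).
  have k_ge0 : 0 <= complex.Re (K1 s 0 0) := ltW (sobolev_kernel_diag_gt0 (K1_rk s s0)).
  have k1_ge0 := le_trans k_ge0 k1_le.
  have d2 : 0 <= d%:R / 2 :> R by rewrite divr_ge0.
  have halfE : 2 `^ (- (d%:R / 2)) = 2^-1 `^ (d%:R / 2) :> R.
    by rewrite -(powR_inv1 (ler0n R 2)) -powRrM mulN1r.
  rewrite /= Kd emb /= powR12_sqrt ?exprn_ge0//; split=> //.
  - by rewrite -powR12_sqrt ?exprn_ge0// -powR_mulrn// -powRrM.
  - by rewrite ler_wpM2r ?invr_ge0 ?sqrtr_ge0// ge0_ler_powR.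
  - rewrite ler_wpM2r ?invr_ge0 ?sqrtr_ge0//.
    rewrite halfE.
    by rewrite ge0_ler_powR ?nnegrE// invr_ge0.
move=> s H rho hyp; exists 2, 2; split=> // eps d /andP[e0 e1] d0.
have [s0 rkH hrho] := hyp d d0.
have [_ _ pts] := bounds (s d) d s0 (H d) rkH.
have [k1_le k_half] := andP (sobolev_kernel_diag_le_half s0 (K1_rk _ s0) (K1_rk 1%N isT)).
have k_ge0 : 0 <= complex.Re (K1 (s d) 0 0) := ltW (sobolev_kernel_diag_gt0 (K1_rk _ s0)).
have q1 : 1 <= eps ^- 2.
  by rewrite -exprVn exprn_ege1// invf_ge1.
(* The least integer above eps^-2; it is at most 2 eps^-2 as eps <= 1. *)
pose n := (Num.trunc (eps ^- 2)).+1.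
have [x hx] := pts (@rho d) n hrho isT.
have q0 : 0 <= eps ^- 2 by rewrite (le_trans ler01).
have /andP[n1 n2] := truncn_itv q0.
apply: (@le_trans _ _ n%:R%:E).
  apply: (information_complexity_le (x := x)); apply: le_trans hx _; rewrite lee_fin.
  have sn : 0 < Num.sqrt n%:R :> R by rewrite sqrtr_gt0.
  rewrite ler_pdivrMr// -[leLHS]mul1r.
  apply: (@le_trans _ _ 1).
    rewrite mul1r -[leRHS]sqrtr1; apply: ler_wsqrtr.
    apply: exprn_ile1 => //; apply: le_trans k1_le (le_trans k_half _).
    by rewrite invf_le1// ler1n.
  rewrite -ler_pdivrMl// mulr1 -(ler_pXn2r (ltn0Sn 1)) ?nnegrE ?invr_ge0 ?sqrtr_ge0 ?(ltW e0)//.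
  by rewrite sqr_sqrtr// exprVn; exact: ltW n2.
rewrite lee_fin powRN (powR_mulrn 2 (ltW e0)) /n -natr1 mulr_natl mulr2n.
exact: lerD.
Qed.
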